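(* Let $p$ be a homogeneous polynomial of degree $n$ in $m$ real variables, hyperbolic in direction $e$ with $p(e)=1$. Let $\mathbf{X}_0=(x_1,\dots,x_n)$ be an $n$-tuple of $e$-nonnegative vectors with $d_0=\sum_{i=1}^nx_i\in C_e$, and consider the hyperbolic Sinkhorn iteration $\mathbf{X}_{j+1}=HS(\mathbf{X}_j)$, $j\ge0$. Then the following are equivalent: (1) there exists $j\ge0$ with $DS(\mathbf{X}_j)\le\frac1n$; (2) $\mathrm{Cap}(\mathbf{X}_0)>0$; (3) $\lim_{j\to\infty}DS(\mathbf{X}_j)=0$.
   Context: $p$ is hyperbolic in direction $e$ if for every $x$ the polynomial $\lambda\mapsto p(x-\lambda e)$ has $n$ real roots (with multiplicity), ordered $\lambda_1(x)\ge\dots\ge\lambda_n(x)$; $x$ is $e$-nonnegative if $\lambda_n(x)\ge0$, $e$-positive if $\lambda_n(x)>0$; $C_e$ is the cone of $e$-positive vectors. $p$ is also hyperbolic in every direction $d\in C_e$, and $\mathrm{tr}_d(x)$ is the sum of the roots of $t\mapsto p(x-td)$. For an $e$-nonnegative tuple $\mathbf{X}=(y_1,\dots,y_n)$ with $d=\sum_iy_i\in C_e$: the hyperbolic Sinkhorn map is $HS(\mathbf{X})=\big(\frac{y_1}{\mathrm{tr}_d(y_1)},\dots,\frac{y_n}{\mathrm{tr}_d(y_n)}\big)$, and the doubly stochastic defect is $DS(\mathbf{X})=\sum_{i=1}^n(\mathrm{tr}_d(y_i)-1)^2$. $\mathrm{Cap}(y_1,\dots,y_n)=\inf\{p(\sum_i\alpha_iy_i):\alpha_i>0,\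 \prod_i\alpha_i=1\}$. *)

(* Defs.v *)
From mathcomp Require Import all_boot all_order all_algebra.
From mathcomp Require Import all_classical all_reals all_analysis.
From mathcomp Require Import polyrcf.
(* The notations of mpoly clash with those of mathcomp-analysis. *)
From mathcomp Require Import -(notations) mpoly.

Set Implicit Arguments.
Unset Strict Implicit.
Unset Printing Implicit Defensive.

Import Order.TTheory GRing.Theory Num.Theory.
Import numFieldNormedType.Exports.
Local Open Scope ring_scope.

Definition peval (R : realType) (m : nat) (p : mpoly m R) (x : 'rV[R]_m) : R :=
  meval (fun i => x 0 i) p.

(* All real roots of q, repeated according to multiplicity, in nonincreasing
   order; [::] when q = 0. *)
Definition real_roots (R : realType) (q : {poly R}) : seq R :=
  sort >=%R (flatten [seq nseq (mup a q) a | a <- rootsR q]).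

Lemma count_real_roots (R : realType) (q : {poly R}) (a : R) :
  q != 0 -> count_mem a (real_roots q) = mup a q.
Proof.
move=> q0; rewrite /real_roots (permP (permEl (perm_sort _ _))) count_flatten.
rewrite -map_comp sumnE big_map.
under eq_bigr => b _ do rewrite /= count_nseq /=.
have rP b : (b \in rootsR q) = root q b.
  by rewrite -[RHS]/((b \in `]-oo, +oo[) && root q b) (roots_on_rootsR q0).
have [ar|/negPf nar] := boolP (a \in rootsR q); last first.
  rewrite big1_seq ?mupNroot -?rP ?nar // => b /andP[_ br].
  by case: eqVneq br nar => [->->|].
rewrite (bigD1_seq a) ?uniq_roots //= eqxx mul1n big1 ?addn0 // => b /negPf ba.
by rewrite ba.
Qed.

(* The univariate polynomial p(x - 'X e). *)
Definition line_poly (R : realType) (m : nat) (p : mpoly m R)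
    (x e : 'rV[R]_m) : {poly R} :=
  mmap (@polyC R) (fun i => (x 0 i)%:P - e 0 i *: 'X) p.

Lemma horner_line_poly (R : realType) (m : nat) (p : mpoly m R)
    (x e : 'rV[R]_m) (t : R) :
  (line_poly p x e).[t] = peval p (x - t *: e).
Proof.
rewrite /line_poly /peval /meval /mmap horner_sum; apply: eq_bigr => k _.
rewrite hornerM hornerC /mmap1 horner_prod; congr (_ * _).
by apply: eq_bigr => i _; rewrite horner_exp !hornerE !mxE [t * _]mulrC.
Qed.

Definition hroots (R : realType) (m : nat) (p : mpoly m R)
    (e x : 'rV[R]_m) : seq R :=
  real_roots (line_poly p x e).

Definition hyperbolic (R : realType) (m n : nat) (p : mpoly m R)
    (e : 'rV[R]_m) : Prop :=
  forall x : 'rV[R]_m, size (hroots p e x) = n.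

(* hlambda p e x i is the root lambda_(i+1)(x): indices start at 0, so that for
   p of degree n the smallest root is hlambda p e x n.-1. *)
Definition hlambda (R : realType) (m : nat) (p : mpoly m R)
    (e x : 'rV[R]_m) (i : nat) : R :=
  (hroots p e x)`_i.

Definition e_nonneg (R : realType) (m n : nat) (p : mpoly m R)
    (e x : 'rV[R]_m) : Prop :=
  0 <= hlambda p e x n.-1.

Definition e_positive (R : realType) (m n : nat) (p : mpoly m R)
    (e x : 'rV[R]_m) : Prop :=
  0 < hlambda p e x n.-1.

Definition htrace (R : realType) (m : nat) (p : mpoly m R)
    (d x : 'rV[R]_m) : R :=
  \sum_(a <- hroots p d x) a.

Definition tuple_sum (R : realType) (m n : nat) (X : 'I_n -> 'rV[R]_m) :
    'rV[R]_m :=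
  \sum_(i < n) X i.

(* Since 0^-1 = 0, an entry of trace 0 is sent to the zero vector; for a tuple
   of e-nonnegative vectors with e-positive sum, an entry of trace 0 has all its
   roots equal to 0. *)
Definition HS (R : realType) (m n : nat) (p : mpoly m R)
    (X : 'I_n -> 'rV[R]_m) : 'I_n -> 'rV[R]_m :=
  fun i => (htrace p (tuple_sum X) (X i))^-1 *: X i.

Definition DS (R : realType) (m n : nat) (p : mpoly m R)
    (X : 'I_n -> 'rV[R]_m) : R :=
  \sum_(i < n) (htrace p (tuple_sum X) (X i) - 1) ^+ 2.

(* The set is nonempty (take alpha = 1) and, for e-nonnegative entries and
   p(e) = 1, bounded below by 0, so the real-valued infimum is the true one. *)
Definition Cap (R : realType) (m n : nat) (p : mpoly m R)
    (X : 'I_n -> 'rV[R]_m) : R :=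
  inf [set r : R | exists alpha : 'I_n -> R,
         [/\ forall i, 0 < alpha i, \prod_(i < n) alpha i = 1
           & r = peval p (\sum_(i < n) alpha i *: X i)]]%classic.

Definition sinkhorn (R : realType) (m n : nat) (p : mpoly m R)
    (X0 : 'I_n -> 'rV[R]_m) (j : nat) : 'I_n -> 'rV[R]_m :=
  iter j (HS p) X0.

(* Main.v *)
Require Import Defs.
From mathcomp Require Import all_boot all_order all_algebra.
From mathcomp Require Import all_classical all_reals all_analysis.
From mathcomp Require Import -(notations) mpoly.
From mathcomp Require Import polyrcf complex zify ring lra.
Import Order.TTheory GRing.Theory Num.Theory.
Import numFieldNormedType.Exports.
Local Open Scope ring_scope.

(* Garding's theory of hyperbolic polynomials is obtained from one homotopy
   principle: along a path of complex polynomials of constant degree none of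
   which has a real root, no root can enter the upper half-plane. It gives
   hyperbolicity in every e-positive direction and the convexity of the cone;
   stability of p then shows that the trace tr_d(u) decreases when an e-nonnegative
   vector is added to d.
   (2) => (3): the product A_j of the scaling factors is nondecreasing, and it is
   bounded because Cap(X_0) A_j <= p(d_j) <= p(d_0) by AM-GM; a quantitative AM-GM
   gives DS(X_j) <= 4 n (A_{j+1} - A_j).
   (1) => (2): if DS(y) <= 1/n then the trace of the sum of any k of the y_i exceeds
   k - 1 by at least 1/(2n). Starting from p(\sum_i alpha_i y_i), lower
   the largest alpha_i successively to the next value: when the k largest
   ones, all equal, are divided by beta, the value drops by a factor at least
   beta^k / (2n), by the trace bound and its monotonicity. At the end all
   alpha_i are equal. *)

Set Implicit Arguments.
Unset Strict Implicit.
Unset Printing Implicit Defensive.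

(** * Restriction of multivariate polynomials to lines *)

Section Lines.
Context (K : comNzRingType) (m : nat).
Implicit Types (q : mpoly m K) (a b : 'rV[K]_m) (c t : K).

Definition ev q a : K := meval (fun i => a 0 i) q.

(** The direction enters with the opposite sign to [line_poly]. The ring is arbitrary because
    restrictions are also taken over [R[i]] and over polynomials in a homotopy parameter. *)
Definition line q a b : {poly K} :=
  mmap (@polyC K) (fun i => (a 0 i)%:P + b 0 i *: 'X) q.

Definition dirder q b a : K := \sum_i b 0 i * ev (mderiv i q) a.

Lemma evZ n q c a : q \is ishomog1 n (@mdeg m) -> ev q (c *: a) = c ^+ n * ev q a.
Proof.
move=> /dhomogP hq; rewrite /ev !mevalE mulr_sumr big_seq [RHS]big_seq.
apply: eq_bigr => k /hq dk; rewrite mulrCA; congr (_ * _).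
under eq_bigr do rewrite mxE exprMn.
rewrite big_split /=; congr (_ * _).
by rewrite prodrXr -mdegE; congr (_ ^+ _).
Qed.

Lemma horner_line q a b t : (line q a b).[t] = ev q (a + t *: b).
Proof.
rewrite /line /ev /meval /mmap horner_sum; apply: eq_bigr => k _.
rewrite hornerM hornerC /mmap1 horner_prod; congr (_ * _).
by apply: eq_bigr => i _; rewrite horner_exp !hornerE !mxE mulrC.
Qed.

(** The coefficient [c] may be 0, so that the notion is multiplicative for all directions [b]. *)
Let top (f : {poly K}) (k : nat) c := (size f <= k.+1)%N /\ f`_k = c.

Let topM f g k l c d : top f k c -> top g l d -> top (f * g) (k + l) (c * d).
Proof.
move=> [sf <-] [sg <-]; split.
  by apply: leq_trans (size_polyMleq _ _) _; lia.
rewrite coefM (bigD1 (inord k)) //= inordK ?ltnS ?leq_addr //.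
rewrite addKn big1 ?addr0 // => -[j /= jl] /eqP jk.
have [kj|jk'|E] := ltngtP j k.
- by rewrite [g`__]nth_default ?mulr0 //; apply: leq_trans sg _; lia.
- by rewrite nth_default ?mul0r //; apply: leq_trans sf _.
- by case: jk; apply: val_inj; rewrite /= inordK ?ltnS ?leq_addr.
Qed.

(** By homogeneity each monomial restricts to a product of exactly [n] affine factors, and their
    coefficients of ['X] are coordinates of [b]. *)
Lemma line_top n q a b : q \is ishomog1 n (@mdeg m) ->
  (size (line q a b) <= n.+1)%N /\ (line q a b)`_n = ev q b.
Proof.
move=> /dhomogP hq; rewrite /line /ev mevalE /mmap.
suff H k : k \in msupp q ->
    top (mmap1 (fun i => (a 0 i)%:P + b 0 i *: 'X) k) n (\prod_i b 0 i ^+ k i).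
  split.
    apply: (leq_trans (size_sum _ _ _)); apply/bigmax_leqP_seq => k /H[s _] _.
    by rewrite mul_polyC (leq_trans (size_scale_leq _ _)).
  rewrite coef_sum big_seq [RHS]big_seq; apply: eq_bigr => k /H[_ <-].
  by rewrite coefCM.
move=> /hq /esym; rewrite [X in _ = X]mdegE => ->; rewrite /mmap1.
have T1 : top 1 0 1 by split; rewrite ?size_poly1 ?coefC.
elim/big_rec3: _ => //= i x y z _ T; apply: topM T.
have Ti : top ((a 0 i)%:P + b 0 i *: 'X) 1 (b 0 i).
  split; last by rewrite coefD coefC coefZ coefX mulr1 add0r.
  rewrite (leq_trans (size_polyD _ _)) // geq_max.
  rewrite (leq_trans (size_polyC_leq1 _)) //=.
  by rewrite (leq_trans (size_scale_leq _ _)) // size_polyX.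
by elim: (k i) => //= j IH; rewrite !exprS; apply: (topM Ti IH).
Qed.

Lemma line_coef0 q a b : (line q a b)`_0 = ev q a.
Proof. by rewrite -horner_coef0 horner_line scale0r addr0. Qed.

Let linear_coef a b q := (line q a b)`_1 = dirder q b a.

Let linear_coefM a b q1 q2 :
  linear_coef a b q1 -> linear_coef a b q2 -> linear_coef a b (q1 * q2).
Proof.
rewrite /linear_coef => h1 h2.
have -> : line (q1 * q2) a b = line q1 a b * line q2 a b by exact: rmorphM.
rewrite coefM big_ord_recl big_ord1 /= subnn !line_coef0 h1 h2 /dirder.
rewrite mulr_sumr mulr_suml -big_split /=; apply: eq_bigr => i _.
by rewrite mderivM /ev mevalD !mevalM -!/(ev _ _); ring.
Qed.

(** Both sides obey the Leibniz rule and agree on 1 and on the variables, hence on monomials;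
    linearity does the rest. *)
Lemma line_coef1 q a b : (line q a b)`_1 = dirder q b a.
Proof.
have L1 : linear_coef a b 1.
  rewrite /linear_coef /line rmorph1 coefC /= /dirder big1 // => i _.
  by rewrite -mpolyC1 mderivC /ev meval0 mulr0.
have LX j : linear_coef a b (mpolyX _ (mnm1 j)).
  rewrite /linear_coef /line mmapX mmap1U coefD coefC coefZ coefX mulr1 add0r.
  rewrite /dirder (bigD1 j) //= big1 ?addr0.
    rewrite mderivX mnm1E eqxx scale1r /ev mevalX big1 ?mulr1 // => k _.
    by rewrite mnmBE subnn.
  move=> i ij; rewrite mderivX mnm1E eq_sym (negPf ij) scale0r /ev meval0.
  by rewrite mulr0.
elim/mpolyind: q => [|c k q _ _ IH].
  rewrite /line mmap0 coef0 /dirder big1 // => i _.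
  by rewrite mderiv0 /ev meval0 mulr0.
have Lk : linear_coef a b (mpolyX _ k).
  rewrite mpolyXE_id; apply: (big_ind (linear_coef a b)) => //.
    by move=> *; apply: linear_coefM.
  by move=> i _; elim: (k i) => //= j IHj; rewrite exprS; apply: linear_coefM.
rewrite /line mmapD mmapZ coefD coefCM -!/(line _ _ _) IH Lk /dirder.
rewrite mulr_sumr -big_split /=; apply: eq_bigr => i _.
by rewrite mderivD mderivZ /ev mevalD mevalZ; ring.
Qed.

Lemma dirderD q b b' a : dirder q (b + b') a = dirder q b a + dirder q b' a.
Proof. by rewrite -big_split; apply: eq_bigr => i _; rewrite mxE mulrDl. Qed.

Lemma dirderZ q c b a : dirder q (c *: b) a = c * dirder q b a.
Proof. by rewrite mulr_sumr; apply: eq_bigr => i _; rewrite mxE mulrA. Qed.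

Lemma dirder_sum (I : Type) (r : seq I) (P : pred I) q (b : I -> 'rV[K]_m) a :
  dirder q (\sum_(i <- r | P i) b i) a = \sum_(i <- r | P i) dirder q (b i) a.
Proof.
apply: (big_morph (dirder q ^~ a)) => [x y|]; first exact: dirderD.
by rewrite -(scale0r 0) dirderZ mul0r.
Qed.

(** The directional derivative as a polynomial, so that it can be restricted to lines and
    differentiated again. *)
Definition dirpoly q b : mpoly m K := \sum_i b 0 i *: mderiv i q.

Lemma ev_dirpoly q b a : ev (dirpoly q b) a = dirder q b a.
Proof.
by rewrite /ev /dirpoly raddf_sum; apply: eq_bigr => i _; rewrite /= mevalZ.
Qed.

End Lines.

(** * Restriction to lines under a change of coefficients *)

Section LineMorphism.
Context (K L : comNzRingType) (m : nat) (f : {rmorphism K -> L}).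

Lemma map_line (q : mpoly m K) a b :
  map_poly f (line q a b) = line (map_mpoly f q) (map_mx f a) (map_mx f b).
Proof.
elim/mpolyind: q => [|c k q _ _ IH].
  by rewrite /line !raddf0.
rewrite /line [map_mpoly _ _]raddfD /= map_mpolyZ map_mpolyX !mmapD !mmapZ !mmapX rmorphD rmorphM.
rewrite -!/(line _ _ _) /= IH map_polyC; congr (_ * _ + _); rewrite /mmap1 rmorph_prod.
apply: eq_bigr => i _; rewrite rmorphXn rmorphD /= map_polyC map_polyZ map_polyX.
by rewrite !mxE.
Qed.

Lemma ev_map (q : mpoly m K) a : ev (map_mpoly f q) (map_mx f a) = f (ev q a).
Proof.
by rewrite -!(line_coef0 _ _ a) -(line_coef0 _ _ (map_mx f a)) -map_line coef_map. Qed.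

Lemma homog_map n (q : mpoly m K) :
  q \is ishomog1 n (@mdeg m) -> map_mpoly f q \is ishomog1 n (@mdeg m).
Proof.
move=> /dhomogP hq; apply/dhomogP => k; rewrite mcoeff_msupp => kq.
apply: hq; rewrite mcoeff_msupp; apply: contra_neq kq.
by rewrite mcoeff_map_mpoly => ->; rewrite raddf0.
Qed.

End LineMorphism.

(** * Complex polynomials and root homotopy *)

Local Open Scope complex_scope.
Import Normc.
Local Notation Re := (@complex.Re _).
Local Notation Im := (@complex.Im _).

Section ComplexPolynomials.
Context (R : realType).
Implicit Types (z w : R[i]) (f : {poly R[i]}) (F : {poly {poly R[i]}}) (r s t : R).

Lemma normc_ge0 z : 0 <= normc z.
Proof. by case: z => a b; apply: sqrtr_ge0. Qed.

Lemma normc_real r : normc r%:C = `|r|.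
Proof. by rewrite /= expr0n addr0 sqrtr_sqr. Qed.

Lemma normcX z n : normc (z ^+ n) = normc z ^+ n.
Proof. by elim: n => [|n IH]; rewrite ?expr0 ?normc1 // !exprS normcM IH. Qed.

Lemma normc_Im z : `|Im z| <= normc z.
Proof.
by case: z => a b; rewrite -(sqrtr_sqr b) ler_wsqrtr //= lerDr sqr_ge0.
Qed.

Lemma normc_gt0 z : (0 < normc z) = (z != 0).
Proof.
rewrite lt_def normc_ge0 andbT; congr (~~ _).
by apply/eqP/eqP => [/eq0_normc|->]; rewrite ?normc0.
Qed.

Lemma normc_sum (I : Type) (l : seq I) (P : pred I) (E : I -> R[i]) :
  normc (\sum_(i <- l | P i) E i) <= \sum_(i <- l | P i) normc (E i).
Proof.
elim/big_rec2: _ => [|i y z _ yz]; first by rewrite normc0.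
by apply: le_trans (le_normcD _ _) _; rewrite lerD2l.
Qed.

(** Over the complex numbers [f] splits, and each linear factor has modulus at least [r] at [z]. A
    small value therefore reveals a nearby root. *)
Lemma normc_horner_ge f z r : 0 <= r ->
  (forall w, root f w -> r <= normc (z - w)) ->
  normc (lead_coef f) * r ^+ (size f).-1 <= normc f.[z].
Proof.
move=> r0 hr; have [->|f0] := eqVneq f 0.
  by rewrite lead_coef0 normc0 mul0r normc_ge0.
have [l Ef] := closed_field_poly_normal f.
have lc0 : lead_coef f != 0 by rewrite lead_coef_eq0.
have -> : (size f).-1 = size l.
  by rewrite Ef size_scale // size_prod_XsubC.
rewrite [X in _ <= normc X.[_] ]Ef hornerZ normcM; apply: ler_wpM2l; first exact: normc_ge0.
have {}hr : forall w, w \in l -> r <= normc (z - w).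
  by move=> w wl; apply: hr; rewrite Ef rootZ // root_prod_XsubC.
elim: l hr {Ef} => [|w l IH] hr; first by rewrite big_nil hornerC normc1.
rewrite big_cons hornerM !hornerE normcM exprS ler_pM ?exprn_ge0 //.
  by apply: hr; rewrite mem_head.
by apply: IH => v vl; apply: hr; rewrite inE vl orbT.
Qed.

Lemma poly_bounded f r : 0 <= r ->
  exists2 M : R, 0 <= M & forall z, normc z <= r -> normc f.[z] <= M.
Proof.
move=> r0; elim/poly_ind: f => [|f c [M M0 IH]].
  by exists 0 => // z _; rewrite horner0 normc0.
exists (M * r + normc c) => [|z zr]; first by rewrite addr_ge0 ?mulr_ge0 ?normc_ge0.
rewrite hornerMXaddC; apply: le_trans (le_normcD _ _) _; rewrite lerD2r normcM.
by rewrite ler_pM ?normc_ge0 // IH.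
Qed.

Lemma poly_lipschitz f : exists2 M : R, 0 <= M &
  forall z w, normc z <= 1 -> normc w <= 1 ->
    normc (f.[z] - f.[w]) <= M * normc (z - w).
Proof.
elim/poly_ind: f => [|f c [M M0 IH]].
  by exists 0 => // z w _ _; rewrite !horner0 subrr normc0 mul0r.
have [B B0 fB] := poly_bounded f (@ler01 R).
exists (M + B) => [|z w z1 w1]; first by rewrite addr_ge0.
rewrite !hornerMXaddC.
have -> : f.[z] * z + c - (f.[w] * w + c) = (f.[z] - f.[w]) * z + f.[w] * (z - w).
  by ring.
apply: le_trans (le_normcD _ _) _; rewrite !normcM mulrDl lerD //.
  rewrite -[leRHS]mulr1 ler_pM ?normc_ge0 //; exact: IH.
by rewrite ler_wpM2r ?normc_ge0 // fB.
Qed.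

(** The constant is uniform in the outer variable [v]; this is the continuity in the homotopy
    parameter. *)
Lemma bipoly_lipschitz F r : 0 <= r -> exists2 M : R, 0 <= M &
  forall v z w, normc v <= r -> normc z <= 1 -> normc w <= 1 ->
    normc (F.[v%:P].[z] - F.[v%:P].[w]) <= M * normc (z - w).
Proof.
move=> r0; elim/poly_ind: F => [|F c [M M0 IH]].
  by exists 0 => // v z w _ _ _; rewrite !horner0 subrr normc0 mul0r.
have [L L0 cL] := poly_lipschitz c.
exists (M * r + L) => [|v z w vr z1 w1]; first by rewrite addr_ge0 ?mulr_ge0.
rewrite !hornerMXaddC !hornerD !hornerM !hornerC.
have -> : F.[v%:P].[z] * v + c.[z] - (F.[v%:P].[w] * v + c.[w])
   = (F.[v%:P].[z] - F.[v%:P].[w]) * v + (c.[z] - c.[w]) by ring.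
apply: le_trans (le_normcD _ _) _; rewrite !normcM mulrDl lerD ?cL //.
by rewrite mulrAC ler_pM ?normc_ge0 // IH.
Qed.

(** Cauchy's root bound, uniform in [s] because the leading coefficient is the constant [c]. *)
Lemma bipoly_root_bounded F n c :
  (size F <= n.+1)%N -> F`_n = c%:P -> c != 0 ->
  exists2 B : R, 0 <= B &
  forall s z, 0 <= s <= 1 -> F.[z%:P].[s%:C] = 0 -> normc z <= B.
Proof.
move=> sF Fn c0.
have /choice[b hb] (k : nat) : exists B : R,
    0 <= B /\ forall z, normc z <= 1 -> normc (F`_k).[z] <= B.
  by have [B ? ?] := poly_bounded F`_k (@ler01 R); exists B.
pose M := \sum_(k < n) b k.
have M0 : 0 <= M by apply: sumr_ge0 => k _; have [] := hb k.
exists (1 + M / normc c) => [|s z s01 Fz].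
  by rewrite addr_ge0 // divr_ge0 // normc_ge0.
have [z1|z1] := leP (normc z) 1.
  by rewrite (le_trans z1) // lerDl divr_ge0 // normc_ge0.
apply: le_trans (_ : M / normc c <= _); last by rewrite lerDr.
rewrite ler_pdivlMr ?normc_gt0 //.
have {}Fz : c * z ^+ n = - \sum_(k < n) (F`_k).[s%:C] * z ^+ k.
  apply/eqP; rewrite -addr_eq0 addrC -[X in _ == X]Fz (horner_coef_wide _ sF) horner_sum.
  rewrite big_ord_recr /= Fn hornerM -polyC_exp !hornerC; apply/eqP; congr (_ + _).
by apply: eq_bigr => k _; rewrite hornerM -polyC_exp hornerC.
have zn0 : 0 < normc z ^+ n by rewrite exprn_gt0 // (lt_trans ltr01).
have : normc c * normc z ^+ n * normc z <= M * normc z ^+ n.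
  rewrite -normcX -normcM Fz normcN mulr_suml.
  apply: le_trans (ler_wpM2r (normc_ge0 z) (normc_sum _ _ _)) _.
  rewrite mulr_suml ler_sum // => k _; rewrite normcM -mulrA.
  rewrite ler_pM ?mulr_ge0 ?normc_ge0 //.
    by have [_] := hb k; apply; rewrite normc_real ger0_norm; case/andP: s01.
  by rewrite !normcX -exprSr ler_weXn2l // ltW.
by move=> h; rewrite -(ler_pM2r zn0) [normc z * normc c]mulrC mulrAC.
Qed.

(* At the infimum of the parameters [s] for which an upper root exists, there is
   no upper root (it would persist for smaller [s]), hence all roots have
   imaginary part at most some [- r] and none can be near the real axis. *)
Lemma no_upper_root_homotopy F n c :
  (size F <= n.+1)%N -> F`_n = c%:P -> c != 0 ->
  (forall s r, 0 <= s <= 1 -> F.[r%:C%:P].[s%:C] != 0) ->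
  (forall z, 0 < Im z -> F.[z%:P].[0] != 0) ->
  forall z, 0 < Im z -> F.[z%:P].[1] != 0.
Proof.
move=> sF Fn c0 Freal F0 z1 Im1; apply/eqP => Fz1.
(* The outer variable of [F] is the root variable; its coefficients are polynomials in the
   parameter, here fixed to [s]. *)
pose f s := map_poly (horner_eval s%:C) F.
have fE s z : (f s).[z] = F.[z%:P].[s%:C].
  have -> : z = horner_eval s%:C z%:P by rewrite /horner_eval hornerC.
  by rewrite horner_map /= /horner_eval hornerC.
have fn s : (f s)`_n = c by rewrite coef_map /= /horner_eval Fn hornerC.
have szf s : size (f s) = n.+1.
  apply/eqP; rewrite eqn_leq (leq_trans (size_poly _ _)) //=.
  by rewrite ltnNge; apply: contra c0 => /leq_sizeP/(_ _ (leqnn _)); rewrite fn => ->.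
have lcf s : lead_coef (f s) = c by rewrite /lead_coef szf fn.
pose T := [set s : R | 0 <= s <= 1 /\ exists2 z, 0 < Im z & (f s).[z] = 0]%classic.
have T1 : T 1 by split; [rewrite ler01 lexx | exists z1 => //; rewrite fE].
have lbT : lbound T 0 by move=> s [/andP[]].
have hT : has_inf T by split; [exists 1 | exists 0].
pose s0 := inf T.
have s0_ge0 : 0 <= s0 by apply: lb_le_inf; [exists 1|].
have s0_le s : T s -> s0 <= s by move=> Ts; apply: ge_inf => //; exists 0.
have s0_le1 : s0 <= 1 by apply: s0_le.
have s01 : 0 <= s0 <= 1 by rewrite s0_ge0.
have ns s : 0 <= s <= 1 -> normc s%:C <= 1.
  by move=> /andP[a b]; rewrite normc_real ger0_norm.
have gap z r s M : 0 <= M -> 0 <= r ->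
    (forall w, root (f s) w -> r <= normc (z - w)) ->
    (f s).[z] = 0 \/ normc (f s).[z] <= M -> normc c * r ^+ n <= M.
  move=> M0 r0 hw hM; have := normc_horner_ge r0 hw; rewrite lcf szf /=.
  by case: hM => [->|h] H; [rewrite normc0 in H; lra | lra].
have noU z : 0 < Im z -> (f s0).[z] != 0.
  move=> Imz; apply/eqP => fz.
  have s0_gt0 : 0 < s0.
    rewrite lt_neqAle s0_ge0 andbT; apply/eqP => E.
    have := fE s0 z; rewrite fz -E => /esym/eqP; apply/negP; exact: F0 Imz.
  have [M M0 FM] := bipoly_lipschitz F (normc_ge0 z).
  pose e := normc c * Im z ^+ n.
  have e0 : 0 < e by rewrite mulr_gt0 ?normc_gt0 ?exprn_gt0.
  (* At [s0 - d] the value at [z] is at most [M * d < e]. Without an upper root there, all roots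
     would be at distance at least [Im z] from [z], contradicting [gap]. *)
  pose d := Num.min s0 (e / (2 * (M + 1))).
  have d0 : 0 < d by rewrite lt_min s0_gt0 divr_gt0 //; lra.
  have ds0 : d <= s0 by rewrite ge_min lexx.
  have dM : M * d < e.
    have : d <= e / (2 * (M + 1)) by rewrite ge_min lexx orbT.
    rewrite ler_pdivlMr; last by lra.
    nra.
  have s1 : 0 <= s0 - d <= 1 by apply/andP; split; lra.
  suff : T (s0 - d) by move=> /s0_le; lra.
  split=> //; apply/not_exists2P => hw.
  have : e <= M * d.
    apply: (@gap z _ (s0 - d)); [nra | exact: ltW | |].
      move=> w /rootP fw; have [Imw|Imw] := ltP 0 (Im w).
        by case: (hw w) => //; case.
      have := normc_Im (z - w); rewrite raddfB /=; move/(le_trans (ler_norm _)).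
      lra.
    right; have := FM z (s0 - d)%:C s0%:C (lexx _) (ns _ s1) (ns _ s01).
    rewrite -!fE fz subr0 -rmorphB normc_real /= addrAC subrr sub0r normrN.
    by rewrite gtr0_norm.
  lra.
have [l Ef] := closed_field_poly_normal (f s0).
have rootl w : root (f s0) w -> w \in l.
  by rewrite Ef rootZ ?root_prod_XsubC // lcf.
have Iml w : root (f s0) w -> Im w < 0.
  case: w => a b /rootP fw /=; have [//|b0|b0] := ltgtP b 0.
    by have /eqP[] := noU (a +i* b) b0.
  by have /eqP[] := Freal _ a s01; rewrite -fE -fw b0.
(* The finitely many roots of [f s0] lie strictly below the real axis, hence below it by a uniform
   margin [r]. *)
have [r r0 hr] : exists2 r : R, 0 < r & forall w, root (f s0) w -> Im w <= - r.
  have [r r0 hr] : exists2 r : R, 0 < r &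
      forall w, w \in l -> Im w < 0 -> Im w <= - r.
    elim: {Ef rootl} l => [|v l [r r0 hr]]; first by exists 1.
    exists (if Im v < 0 then Num.min r (- Im v) else r).
      by case: ifP => // ?; rewrite lt_min r0; lra.
    move=> w; rewrite inE => /orP[/eqP->|/hr h] w0.
      rewrite w0.
      have : Num.min r (- Im v) <= - Im v by rewrite ge_min lexx orbT.
      lra.
    have := h w0; case: ifP => // _.
    have : Num.min r (- Im v) <= r by rewrite ge_min lexx.
    lra.
  by exists r => // w fw; apply: hr; [apply: rootl | apply: Iml].
have [B B0 FB] := bipoly_root_bounded sF Fn c0.
have [M M0 FM] := bipoly_lipschitz F B0.
pose e := normc c * r ^+ n.
have e0 : 0 < e by rewrite mulr_gt0 ?normc_gt0 ?exprn_gt0.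
have d0 : 0 < e / (2 * (M + 1)) by rewrite divr_gt0 //; lra.
(* A parameter of [T] this close to [s0] has an upper root [z] at which [f s0] is smaller than [e],
   although [z] is at distance at least [r] from all roots of [f s0]. *)
have [s Ts ss0] := inf_adherent d0 hT.
have {}ss0 : s < s0 + e / (2 * (M + 1)) by [].
have s0s := s0_le _ Ts; case: Ts => s1 [z Imz fz].
have : e <= M * (s - s0).
  apply: (@gap z _ s0); [nra | exact: ltW | |].
    move=> w /hr ?; have := normc_Im (z - w); rewrite raddfB /=.
    move/(le_trans (ler_norm _)); lra.
  right; have := FM z s%:C s0%:C (FB _ _ s1 _) (ns _ s1) (ns _ s01).
  rewrite -!fE fz sub0r normcN -rmorphB normc_real /= ger0_norm ?subr_ge0 //.
  exact.
have : M * (s - s0) <= M * (e / (2 * (M + 1))) by apply: ler_wpM2l => //; lra.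
suff : M * (e / (2 * (M + 1))) < e by lra.
rewrite mulrA ltr_pdivrMr; [nra | lra].
Qed.

End ComplexPolynomials.

(** * Real-rooted polynomials *)

Section RealRootedPolynomials.
Context (R : realType).
Implicit Types (f g : {poly R}) (l : seq R) (a b c r s t : R).

Lemma mup_scale_prod c l a : c != 0 ->
  mup a (c *: \prod_(x <- l) ('X - x%:P)) = count_mem a l.
Proof.
move=> c0; rewrite -mul_polyC mupMr ?rootC //.
elim: l => [|x l IH]; first by rewrite big_nil mupNroot // root1.
rewrite big_cons mupM ?polyXsubC_eq0 ?monic_neq0 ?monic_prod_XsubC // IH /=.
by rewrite -['X - _]expr1 mup_XsubCX; case: eqVneq.
Qed.

Lemma real_roots_prod c l : c != 0 ->
  perm_eq (real_roots (c *: \prod_(x <- l) ('X - x%:P))) l.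
Proof.
move=> c0; apply/allP => a _ /=; rewrite count_real_roots ?mup_scale_prod //.
by rewrite scaler_eq0 negb_or c0 monic_neq0 ?monic_prod_XsubC.
Qed.

Lemma prod_XsubC_dvd_mup f l : f != 0 ->
  (forall a, (count_mem a l <= mup a f)%N) -> \prod_(x <- l) ('X - x%:P) %| f.
Proof.
elim: l f => [|x l IH] f f0 hl; first by rewrite big_nil dvd1p.
have : 'X - x%:P %| f.
  rewrite -['X - _]expr1 -mup_geq //; apply: leq_trans (hl x).
  by rewrite /= eqxx.
rewrite big_cons => /dvdpP[g fE]; move: f0 hl; rewrite {}fE => f0 hl.
have g0 : g != 0 by apply: contraNneq f0 => ->; rewrite mul0r.
rewrite mulrC dvdp_mul2r ?polyXsubC_eq0 //; apply: IH => // a.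
have := hl a; rewrite mupM ?polyXsubC_eq0 //= -['X - _]expr1 mup_XsubCX.
by case: (eqVneq x a) => _ /=; rewrite ?addn1 ?addn0.
Qed.

Lemma real_roots_split f n : (size f <= n.+1)%N -> f != 0 ->
  size (real_roots f) = n ->
  f = lead_coef f *: \prod_(a <- real_roots f) ('X - a%:P).
Proof.
move=> sf f0 sr; have gf : \prod_(a <- real_roots f) ('X - a%:P) %| f.
  by apply: prod_XsubC_dvd_mup => // a; rewrite count_real_roots.
set g := \prod_(_ <- _) _ in gf *.
have gm : g \is monic by apply: monic_prod_XsubC.
have sg : size g = n.+1 by rewrite size_prod_XsubC sr.
have /dvdpP[h fE] := gf.
have h0 : h != 0 by apply: contraNneq f0 => h0; rewrite fE h0 mul0r.
have sh : (size h <= 1)%N.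
  by move: sf; rewrite fE size_Mmonic // sg addnS -[n.+1]add1n leq_add2r.
rewrite fE lead_coef_Mmonic // (size1_polyC sh) lead_coefC mul_polyC.
by [].
Qed.

Lemma complex_real_split f :
  (forall z, root (map_poly (real_complex R) f) z -> Im z = 0) ->
  exists l, f = lead_coef f *: \prod_(a <- l) ('X - a%:P).
Proof.
move=> hf; have [->|f0] := eqVneq f 0.
  by exists [::]; rewrite lead_coef0 scale0r.
have [l Ef] := closed_field_poly_normal (map_poly (real_complex R) f).
exists (map Re l); apply: (map_inj_poly (@complexI R)) => //.
rewrite {}Ef lead_coef_map in hf *.
have {}hf : {in l, forall z, Im z = 0}.
  move=> z zl; apply: hf; rewrite rootZ ?root_prod_XsubC //.
  by rewrite fmorph_eq0 lead_coef_eq0.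
rewrite map_polyZ rmorph_prod big_map; congr (_ *: _).
apply: eq_big_seq => z /hf; case: z => x y /= ->.
by rewrite rmorphB /= map_polyX map_polyC.
Qed.

Lemma prod_le1_of_sum l : (forall a, a \in l -> 0 <= a) ->
  \sum_(a <- l) a = (size l)%:R -> \prod_(a <- l) a <= 1.
Proof.
move=> l0 sl; have [l_gt0|] := ltnP 0 (size l); last first.
  by case: l {l0 sl} => // _; rewrite big_nil.
have /(@leif_AGM R 'I_(size l) predT) [+ _] :
    {in predT, forall i, 0 <= tnth (in_tuple l) i}.
  by move=> i _; rewrite l0 ?mem_tnth.
rewrite cardT size_enum_ord -!(big_tnth _ _ _ predT id) sl divff ?expr1n //.
by rewrite pnatr_eq0 -lt0n.
Qed.

(** The logarithm of the product is concave in the entries, so the worst case has [k] entries 1, one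
    entry [r] and zeros elsewhere. The induction exchanges the head [a] against [r]: the remainder
    becomes [r - a] if [a <= r], and [1 + r - a] with one entry 1 fewer otherwise. *)
Lemma prod_ge_of_sum l b k r : 0 <= b -> 0 <= r <= 1 ->
  (forall a, a \in l -> 0 <= a <= 1) -> k%:R + r <= \sum_(a <- l) a ->
  (1 + b) ^+ k * (1 + b * r) <= \prod_(a <- l) (1 + b * a).
Proof.
move=> b0; elim: l k r => [|a l IH] k r /andP[r0 r1] hl.
  rewrite !big_nil; case: k => [|k]; last by have := ler0n R k; rewrite -natr1; lra.
  move=> h; have -> : r = 0 by lra.
  by rewrite expr0 mul1r mulr0 addr0.
have /andP[a0 a1] := hl a (mem_head _ _).
have {}hl : forall x, x \in l -> 0 <= x <= 1 by move=> x xl; rewrite hl // inE xl orbT.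
have b1 : 0 <= 1 + b * a by nra.
rewrite !big_cons => h; have [ar|ra] := leP a r.
  have /(IH k (r - a)) /(_ hl) IH' : 0 <= r - a <= 1 by apply/andP; split; lra.
  have S : k%:R + (r - a) <= \sum_(x <- l) x by lra.
  apply: (le_trans _ (ler_wpM2l b1 (IH' S))).
  rewrite mulrCA ler_wpM2l ?exprn_ge0 //; first by lra.
  have ra0 : 0 <= r - a by lra.
  have : 0 <= b * b * (a * (r - a)) by rewrite !mulr_ge0.
  nra.
case: k h => [|k] h.
  have l1 : 1 <= \prod_(x <- l) (1 + b * x).
    have s0 : 0%:R + 0 <= \sum_(x <- l) x.
      by rewrite addr0 big_seq sumr_ge0 // => x /hl /andP[].
    have /IH /(_ hl s0) : 0 <= (0 : R) <= 1 by rewrite lexx ler01.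
    by rewrite expr0 mul1r mulr0 addr0.
  rewrite expr0 mul1r; apply: le_trans (_ : (1 + b * a) * 1 <= _).
    by rewrite mulr1 lerD2l ler_wpM2l // ltW.
  by rewrite ler_wpM2l.
have /(IH k (1 + r - a)) /(_ hl) IH' : 0 <= 1 + r - a <= 1 by apply/andP; split; lra.
have S : k%:R + (1 + r - a) <= \sum_(x <- l) x by move: h; rewrite -natr1; lra.
apply: (le_trans _ (ler_wpM2l b1 (IH' S))).
rewrite mulrCA exprSr -mulrA ler_wpM2l ?exprn_ge0 //; first by lra.
have : 0 <= b * b * ((1 - a) * (a - r)) by rewrite !mulr_ge0 //; lra.
nra.
Qed.

Lemma poly_le0_at0 f : (forall t, 0 < t -> f.[t] <= 0) -> f.[0] <= 0.
Proof.
move=> hf; rewrite leNgt; apply/negP => f0.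
have [d d0 hd] := poly_cont 0 f f0.
have := hd (d / 2); rewrite subr0 gtr0_norm ?divr_gt0 // => h.
have : d / 2 < d by lra.
move=> /h; have := hf (d / 2); rewrite divr_gt0 // => /(_ isT) fd.
by rewrite ltr_distl => /andP[]; lra.
Qed.

(** Taylor expansion at [s]. What matters is that the remainders are [t ^+ 2] times real polynomials
    in [t], so that they disappear at first order in [t]. *)
Lemma horner_complex_taylor f s : exists g h : {poly R}, forall t,
  (map_poly (real_complex R) f).[s +i* t] =
  (f.[s] + t ^+ 2 * g.[t]) +i* (t * f^`().[s] + t ^+ 2 * h.[t]).
Proof.
elim/poly_ind: f => [|f c [g [h IH]]].
  exists 0, 0 => t; rewrite raddf0 deriv0 !horner0 !mulr0 !addr0.
  by [].
exists (s *: g - (f^`().[s])%:P - 'X * h), (s *: h + 'X * g) => t.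
rewrite rmorphD rmorphM /= map_polyX map_polyC hornerD hornerMX hornerC IH.
rewrite derivMXaddC !hornerE.
by apply/eqP; rewrite eq_complex /=; apply/andP; split; apply/eqP; ring.
Qed.

(* A rational function [g / f] mapping the upper half-plane to the lower one
   is nonincreasing on the real line. *)
Lemma derive_quotient_le0 f g s :
  (forall t, 0 < t ->
    Im ((map_poly (real_complex R) g).[s +i* t] *
        ((map_poly (real_complex R) f).[s +i* t])^*) <= 0) ->
  g^`().[s] * f.[s] - g.[s] * f^`().[s] <= 0.
Proof.
have [f1 [f2 Ef]] := horner_complex_taylor f s.
have [g1 [g2 Eg]] := horner_complex_taylor g s => H.
(* ['X * D] is the imaginary part in the hypothesis as a polynomial in [t], and the value of [D] at
   0 is the expression to be bounded. *)
pose D := ((g^`().[s])%:P + 'X * g2) * (f.[s]%:P + 'X ^+ 2 * f1)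
        - (g.[s]%:P + 'X ^+ 2 * g1) * ((f^`().[s])%:P + 'X * f2).
suff /poly_le0_at0 : forall t, 0 < t -> D.[t] <= 0.
  by rewrite /D !hornerE /= !expr0n /= !mul0r !addr0.
move=> t t0; have := H t t0; rewrite Ef Eg /D /= !hornerE => Ht.
rewrite -(pmulr_rle0 _ t0); apply: le_trans Ht.
by rewrite le_eqVlt; apply/orP; left; apply/eqP; ring.
Qed.

(** The logarithmic derivative at 0 is the sum of [- z^-1] over the roots [z], and each term has
    negative imaginary part. Multiplying by the conjugate instead of dividing keeps the induction on
    the roots polynomial. *)
Lemma Im_log_derivative (f : {poly R[i]}) :
  (forall z, root f z -> Im z < 0) -> Im (f`_1 * (f`_0)^*) <= 0.
Proof.
move=> hf; have [->|f0] := eqVneq f 0; first by rewrite !coef0 mul0r.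
have [l Ef] := closed_field_poly_normal f.
have {}hf : forall z, z \in l -> Im z < 0.
  move=> z zl; apply: hf; rewrite Ef rootZ ?lead_coef_eq0 //.
  by rewrite root_prod_XsubC.
rewrite Ef !coefZ; set c := lead_coef f.
suff H : Im ((\prod_(z <- l) ('X - z%:P))`_1 * ((\prod_(z <- l) ('X - z%:P))`_0)^*) <= 0.
  move: H; case: (_`_1) (_`_0) c => [a b] [a' b'] [x y] /= H.
  have -> : (x * a - y * b) * - (x * b' + y * a') + (x * b + y * a) * (x * a' - y * b')
     = (x ^+ 2 + y ^+ 2) * (a * - b' + b * a') by ring.
  by rewrite mulr_ge0_le0 // addr_ge0 // sqr_ge0.
elim: l hf {Ef} => [|z l IH] hf; first by rewrite big_nil !coefC /= mul0r.
have {}IH : Im ((\prod_(w <- l) ('X - w%:P))`_1 *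
                ((\prod_(w <- l) ('X - w%:P))`_0)^*) <= 0.
  by apply: IH => w wl; apply: hf; rewrite inE wl orbT.
have {}hf := hf z (mem_head _ _).
rewrite big_cons; set g := \prod_(_ <- _) _ in IH *.
have -> : (('X - z%:P) * g)`_1 = g`_0 - z * g`_1.
  by rewrite mulrBl coefB coefXM coefCM.
have -> : (('X - z%:P) * g)`_0 = - (z * g`_0).
  by rewrite mulrBl coefB coefXM coefCM sub0r.
move: IH hf; case: (g`_0) (g`_1) z => [a b] [a' b'] [x y] /= IH y0.
set X := (X in X <= 0).
have -> : X = y * (a ^+ 2 + b ^+ 2) + (x ^+ 2 + y ^+ 2) * (a' * - b + b' * a).
  by rewrite /X; ring.
have : y * (a ^+ 2 + b ^+ 2) <= 0.
  by rewrite nmulr_rle0 // addr_ge0 // sqr_ge0.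
have : (x ^+ 2 + y ^+ 2) * (a' * - b + b' * a) <= 0.
  by rewrite mulr_ge0_le0 // addr_ge0 // sqr_ge0.
lra.
Qed.

End RealRootedPolynomials.

(** * Real polynomials as functions *)

Section PolynomialFunctions.
Context (R : realType).
Implicit Types (f g : {poly R}) (l : seq R) (a b s t : R).

Lemma poly_ext f g : (forall t, f.[t] = g.[t]) -> f = g.
Proof.
move=> fg; apply/eqP; rewrite -subr_eq0; apply/negPn/negP => h0.
pose rs : seq R := [seq i%:R | i <- iota 0 (size (f - g))].
suff : (size rs < size (f - g)%R)%N by rewrite size_map size_iota ltnn.
apply: max_poly_roots => //.
  by apply/allP => t _; rewrite rootE !hornerE fg subrr.
by rewrite map_inj_uniq ?iota_uniq // => i j /eqP; rewrite eqr_nat => /eqP.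
Qed.

Lemma coef_prod_1aX l :
  (\prod_(a <- l) (1 + a *: 'X))`_0 = 1 /\
  (\prod_(a <- l) (1 + a *: 'X))`_1 = \sum_(a <- l) a.
Proof.
elim: l => [|a l [IH0 IH1]]; first by rewrite !big_nil !coefC.
rewrite !big_cons mulrDl mul1r -scalerAl !coefD !coefZ !coefXM IH0 IH1 /=.
by rewrite mulr0 addr0 mulr1 addrC.
Qed.

Lemma seq_gt0_lbound l : (forall a, a \in l -> 0 < a) ->
  exists2 b, 0 < b & forall a, a \in l -> b <= a.
Proof.
elim: l => [|a l IH] hl; first by exists 1.
have [|b b0 hb] := IH; first by move=> x xl; rewrite hl // inE xl orbT.
exists (Num.min a b); first by rewrite lt_min b0 hl ?mem_head.
move=> x; rewrite inE => /orP[/eqP->|/hb]; first by rewrite ge_min lexx.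
by move=> bx; rewrite ge_min bx orbT.
Qed.

Lemma quotient_nonincreasing f g :
  (forall s, 0 <= s -> 0 < f.[s]) ->
  (forall s, 0 <= s -> g^`().[s] * f.[s] - g.[s] * f^`().[s] <= 0) ->
  g.[1] / f.[1] <= g.[0] / f.[0].
Proof.
move=> f0 fg.
pose h s := g.[s] * f.[s]^-1.
pose dh s := g.[s] *: (- f.[s] ^- 2 *: f^`().[s]) + f.[s]^-1 *: g^`().[s].
have dhP s : 0 <= s -> is_derive s 1 h (dh s).
  move=> s0; apply: is_deriveM.
  by apply: is_deriveV; rewrite gt_eqF // f0.
have hc : {within `[0, 1], continuous h}%classic.
  apply: continuous_in_subspaceT => s; rewrite inE /= in_itv /= => /andP[s0 _].
  apply: differentiable_continuous; apply/derivable1_diffP.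
  by have [] := dhP s s0.
have [s|s] := MVT_segment (@ler01 R) (df := dh) _ hc.
  by rewrite in_itv /= => /andP[/ltW s0 _]; apply: dhP.
rewrite in_itv /= => /andP[s0 _]; rewrite subr0 mulr1 -subr_le0 -/(h 1) -/(h 0).
move=> ->; rewrite /dh.
have -> : g.[s] *: (- f.[s] ^- 2 *: f^`().[s]) + f.[s]^-1 *: g^`().[s] =
  (g^`().[s] * f.[s] - g.[s] * f^`().[s]) / f.[s] ^+ 2.
  rewrite /GRing.scale /=; field; exact: lt0r_neq0 (f0 s s0).
by rewrite pmulr_lle0 ?fg // invr_gt0 exprn_gt0 // f0.
Qed.

End PolynomialFunctions.

(** * Root homotopy for restrictions to lines *)

Section LineHomotopy.
Context (R : realType) (m n : nat).
Implicit Types (q : mpoly m R[i]) (A B D : 'rV[R[i]]_m).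

Lemma map_mderiv (K L : comNzRingType) (f : {rmorphism K -> L}) (q : mpoly m K) i :
  map_mpoly f (mderiv i q) = mderiv i (map_mpoly f q).
Proof.
elim/mpolyind: q => [|c k q _ _ IH]; first by rewrite !(raddf0, mderiv0).
rewrite mderivD !raddfD /= IH; congr (_ + _).
rewrite mderivZ !map_mpolyZ mderivZ map_mpolyX !mderivX map_mpolyZ map_mpolyX.
by rewrite rmorph_nat.
Qed.

Lemma map_dirder (K L : comNzRingType) (f : {rmorphism K -> L}) (q : mpoly m K) b :
  map_mpoly f (dirpoly q b) = dirpoly (map_mpoly f q) (map_mx f b).
Proof.
rewrite /dirpoly raddf_sum; apply: eq_bigr => i _.
by rewrite /= map_mpolyZ map_mderiv mxE.
Qed.

(** The polynomials [q (A + s B + z D)] in [z] form a path in [s] of constant degree, because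
    homogeneity makes [ev q D] their common leading coefficient. *)
Lemma path_no_upper_zero q A B D :
  q \is ishomog1 n (@mdeg m) -> ev q D != 0 ->
  (forall s r : R, 0 <= s <= 1 -> ev q (A + s%:C *: B + r%:C *: D) != 0) ->
  (forall z, 0 < Im z -> ev q (A + z *: D) != 0) ->
  forall z, 0 < Im z -> ev q (A + B + z *: D) != 0.
Proof.
move=> hq qD Hreal H0 z Imz.
pose cst (E : 'rV[R[i]]_m) := map_mx (@polyC R[i]) E.
pose F := line (map_mpoly (@polyC R[i]) q) (cst A + 'X *: cst B) (cst D).
have FE w s : F.[w%:P].[s] = ev q (A + s *: B + w *: D).
  rewrite /F horner_line -[LHS]/(horner_eval s _) -ev_map.
  congr (ev _ _).
    by apply/mpolyP => k; rewrite !mcoeff_map_mpoly /= /horner_eval hornerC.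
  by apply/matrixP => i j; rewrite !mxE /= /horner_eval !hornerE.
have [sF Fn] := line_top (cst A + 'X *: cst B) (cst D)
  (homog_map (@polyC R[i]) hq).
rewrite ev_map in Fn.
have := no_upper_root_homotopy sF Fn qD.
move=> /(_ _ _ z Imz); rewrite FE scale1r; apply.
  by move=> s r s01; rewrite FE; apply: Hreal.
by move=> w Imw; rewrite FE scale0r addr0; apply: H0.
Qed.

End LineHomotopy.

(** * Arithmetic-geometric mean inequalities for tuples *)

Section RealTuples.
Context (R : realType) (n : nat).
Implicit Types (t x : 'I_n -> R).

Lemma prod_le1_ord t : (forall i, 0 <= t i) -> \sum_i t i = n%:R ->
  \prod_i t i <= 1.
Proof.
move=> t0 st; have := @prod_le1_of_sum R [seq t i | i : 'I_n].
rewrite size_image card_ord !big_image; apply=> //.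
by move=> a /mapP[i _ ->].
Qed.

Lemma prod_1D_ge x : (forall i, 0 <= x i) -> 1 + \sum_i x i <= \prod_i (1 + x i).
Proof.
move=> x0; suff: 0 <= \sum_i x i /\ 1 + \sum_i x i <= \prod_i (1 + x i) by case.
elim/big_rec2: _ => [|i y z _ [z0 zy]]; first by rewrite addr0.
by have := x0 i; split; [rewrite addr_ge0 | nra].
Qed.

(* AM-GM applied to [(1 + t i) / 2], whose square is
   [t i + (1 - t i) ^+ 2 / 4]. *)
Lemma sum_sqr_dist1_le t : (forall i, 0 < t i) -> \sum_i t i = n%:R ->
  \sum_i (t i - 1) ^+ 2 <= 4 * n%:R * ((\prod_i t i)^-1 - 1).
Proof.
move=> t0 st; have [n0|n_gt0] := posnP n.
  by move: t t0 st; rewrite n0 => t _ _; rewrite !big_ord0 invr1 subrr mulr0.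
have nR : 0 < n%:R :> R by rewrite ltr0n.
have tn i : t i <= n%:R.
  by rewrite -st (bigD1 i) //= lerDl sumr_ge0 // => j _; apply: ltW.
have P0 : 0 < \prod_i t i by apply: prodr_gt0.
(* The divisor absorbs the bound [t i <= n%:R], so that [t i * (1 + x i)] is at most
   [((1 + t i) / 2) ^+ 2]. *)
pose x i := (t i - 1) ^+ 2 / (4 * n%:R).
have x0 i : 0 <= x i by rewrite divr_ge0 ?sqr_ge0 // mulr_ge0.
have h1 : \prod_i ((1 + t i) / 2) <= 1.
  apply: prod_le1_ord => [i|]; first by have := t0 i; lra.
  rewrite -mulr_suml big_split /= st sumr_const cardT size_enum_ord.
  by rewrite -[1 *+ n]/(n%:R); field.
have h2 : \prod_i (t i * (1 + x i)) <= \prod_i ((1 + t i) / 2) ^+ 2.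
  apply: ler_prod => i _; have ti := t0 i.
  rewrite mulr_ge0 ?(ltW ti) ?addr_ge0 //=.
  have -> : ((1 + t i) / 2) ^+ 2 = t i + (t i - 1) ^+ 2 / 4 by field.
  rewrite mulrDr mulr1 lerD2l /x invfM mulrCA ler_wpM2l ?sqr_ge0 //.
  rewrite mulrCA ger_pMr // ler_pdivrMr // mul1r; exact: tn.
have h3 : \prod_i ((1 + t i) / 2) ^+ 2 <= 1.
  rewrite prodrXl expr_le1 // prodr_ge0 // => i _; have := t0 i; lra.
have h4 : (\prod_i t i) * (1 + \sum_i x i) <= 1.
  apply: le_trans (le_trans h2 h3); rewrite big_split /=.
  by rewrite ler_wpM2l ?prod_1D_ge // ltW.
move: h4; rewrite -ler_pdivlMl // mulr1 /x -mulr_suml => h4.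
have : (\sum_i (t i - 1) ^+ 2) / (4 * n%:R) <= (\prod_i t i)^-1 - 1 by lra.
by rewrite ler_pdivrMr ?mulr_gt0 // mulrC.
Qed.

End RealTuples.

(** * Hyperbolic polynomials and Sinkhorn iteration *)

Lemma lmod_addrACA (K : comNzRingType) (V : lmodType K) (x y v : V) (a b c : K) :
  x + c *: y + (a + c * b) *: v = x + a *: v + c *: (y + b *: v).
Proof. by rewrite scalerDl scalerDr -!scalerA addrACA. Qed.

Section Hyperbolic.
Context (R : realType) (m n : nat) (p : mpoly m R) (e : 'rV[R]_m).
Hypotheses (n_gt0 : (0 < n)%N) (p_homog : p \is ishomog1 n (@mdeg m)).
Hypotheses (p_hyp : hyperbolic n p e) (p_e : peval p e = 1).
Implicit Types (x u v d w : 'rV[R]_m) (z : R[i]) (a b c s t r : R).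

Let pC := map_mpoly (real_complex R) p.
Let cx x : 'rV[R[i]]_m := map_mx (real_complex R) x.

Let cxD x y : cx (x + y) = cx x + cx y.
Proof. exact: map_mxD. Qed.

Let cxZ c x : cx (c *: x) = c%:C *: cx x.
Proof. exact: map_mxZ. Qed.

Let cxN x : cx (- x) = - cx x.
Proof. exact: map_mxN. Qed.

Let cplx x y := cx x + 'i *: cx y.

Let cplx0 x : cx x = cplx x 0.
Proof. by rewrite /cplx -(scale0r 0) cxZ scale0r scaler0 addr0. Qed.

Let cplxZ c x y : c%:C *: cplx x y = cplx (c *: x) (c *: y).
Proof. by rewrite /cplx !cxZ scalerDr !scalerA [_ * 'i]mulrC. Qed.

Let cplxDZ x y a b d :
  cplx x y + (a +i* b) *: cx d = cplx (x + a *: d) (y + b *: d).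
Proof.
rewrite /cplx !cxD !cxZ [a +i* b]complexE; exact: lmod_addrACA.
Qed.

Let pC_homog : pC \is ishomog1 n (@mdeg m).
Proof. exact: homog_map. Qed.

Let ev_pC x : ev pC (cx x) = (ev p x)%:C.
Proof. exact: ev_map. Qed.

Let ev_e : ev p e = 1. Proof. exact: p_e. Qed.

(** * Hyperbolic directions and positive vectors in terms of roots *)

Lemma evN x : ev p (- x) = (-1) ^+ n * ev p x.
Proof. by rewrite -scaleN1r (evZ _ _ p_homog). Qed.

Lemma line_polyE x d : line_poly p x d = line p x (- d).
Proof.
apply: poly_ext => t.
by rewrite horner_line_poly horner_line scalerN.
Qed.

(** Real-rootedness in complex form, without multiplicities, as the homotopies produce it. *)
Definition hyperbolic_dir d :=
  forall x z, Im z != 0 -> ev pC (cx x + z *: cx d) != 0.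

(* Root-free forms of e-positivity and e-nonnegativity: all roots of
   [t |-> p (d - t *: e)] are positive, resp. nonnegative. *)
Definition pos d := forall t, 0 <= t -> ev p (d + t *: e) != 0.

Definition nneg x := forall t, 0 < t -> ev p (x + t *: e) != 0.

Lemma line_poly_top x d : ev p d != 0 ->
  size (line_poly p x d) = n.+1 /\
  lead_coef (line_poly p x d) = (-1) ^+ n * ev p d.
Proof.
move=> d0; rewrite line_polyE.
have [sl ln] := line_top x (- d) p_homog; rewrite evN in ln.
have l0 : (line p x (- d))`_n != 0 by rewrite ln mulf_neq0 // signr_eq0.
have E : size (line p x (- d)) = n.+1.
  by apply/eqP; rewrite eqn_leq sl ltnNge; apply: contra l0 => /leq_sizeP ->.
by rewrite /lead_coef E.
Qed.

Lemma hyperbolic_dir_e : hyperbolic_dir e.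
Proof.
move=> x z Imz; apply/eqP => pz.
have e0 : ev p e != 0 by rewrite ev_e oner_eq0.
have [sl lc] := line_poly_top x e0.
have l0 : line_poly p x e != 0 by rewrite -size_poly_gt0 sl.
have E := real_roots_split _ l0 (p_hyp x); rewrite sl in E.
have /rootP : root (map_poly (real_complex R) (line_poly p x e)) (- z).
  apply/rootP; rewrite line_polyE map_line horner_line -pz; congr (ev _ (_ + _)).
  by rewrite map_mxN scalerN scaleNr opprK.
rewrite {}E // map_polyZ hornerZ rmorph_prod horner_prod => /eqP.
rewrite mulf_eq0 /= fmorph_eq0 lead_coef_eq0 (negPf l0) /=.
rewrite prodf_seq_eq0 => /hasP[a _] /=.
rewrite rmorphB /= map_polyX map_polyC !hornerE subr_eq0 => /eqP za.
by move: Imz; rewrite -[z]opprK za /= oppr0 eqxx.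
Qed.

Lemma hroots_dir d x : ev p d != 0 -> hyperbolic_dir d ->
  size (hroots p d x) = n /\
  forall t, ev p (x - t *: d) = ev p d * \prod_(a <- hroots p d x) (a - t).
Proof.
move=> d0 hd; have [sl lc] := line_poly_top x d0.
have l0 : line_poly p x d != 0 by rewrite -size_poly_gt0 sl.
have [|l E] := @complex_real_split _ (line_poly p x d).
  move=> z /rootP; rewrite line_polyE map_line horner_line => pz.
  apply/eqP/negPn/negP => Imz.
  have := hd x (- z); rewrite raddfN oppr_eq0 => /(_ Imz) /eqP[].
  rewrite -pz; congr (ev _ (_ + _)).
  by rewrite map_mxN scalerN scaleNr.
have lc0 : lead_coef (line_poly p x d) != 0 by rewrite lead_coef_eq0.
have P : perm_eq (hroots p d x) l.
  by rewrite /hroots E; apply: real_roots_prod.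
have szl : size l = n.
  by apply/eq_add_S; rewrite -sl E size_scale // size_prod_XsubC.
rewrite (perm_size P); split=> // t.
rewrite -[LHS]/(peval p _) -horner_line_poly E lc hornerZ horner_prod.
rewrite (perm_big _ P) /= mulrAC mulrC -szl; congr (_ * _).
elim: l {E P szl} => [|a l IH]; first by rewrite !big_nil mulr1.
by rewrite !big_cons /= -IH exprS hornerXsubC; ring.
Qed.

Lemma hlambda_min x a : a \in hroots p e x -> hlambda p e x n.-1 <= a.
Proof.
move=> al; rewrite /hlambda -{1}(nth_index 0 al).
have st : sorted >=%R (hroots p e x).
  by apply: sort_sorted => b c; exact: ge_total.
have tr : transitive (>=%R : rel R) by move=> b c d cb bd; exact: le_trans bd cb.
have il : (index a (hroots p e x) < n)%N by rewrite -(p_hyp x) index_mem.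
apply: (sorted_leq_nth tr (@lexx _ _) 0 st); rewrite ?inE ?p_hyp //.
  by rewrite ltn_predL.
by rewrite -ltnS prednK.
Qed.

Lemma ev_roots d x t : ev p d != 0 -> hyperbolic_dir d ->
  ev p (x + t *: d) = ev p d * \prod_(a <- hroots p d x) (a + t).
Proof.
move=> d0 hd; have [_ H] := hroots_dir x d0 hd.
have := H (- t); rewrite scaleNr opprK => ->; congr (_ * _).
by apply: eq_bigr => a; rewrite opprK.
Qed.

Let e_neq0 : ev p e != 0. Proof. by rewrite ev_e oner_eq0. Qed.

Lemma nneg_e_nonneg x : e_nonneg n p e x -> nneg x.
Proof.
move=> hx t t0; rewrite ev_roots //; last exact: hyperbolic_dir_e.
rewrite mulf_neq0 // prodf_seq_neq0; apply/allP => a /hlambda_min al /=.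
by rewrite gt_eqF // ltr_wpDl // (le_trans hx).
Qed.

Lemma pos_e_positive x : e_positive n p e x -> pos x.
Proof.
move=> hx t t0; rewrite ev_roots //; last exact: hyperbolic_dir_e.
rewrite mulf_neq0 // prodf_seq_neq0; apply/allP => a /hlambda_min al /=.
by rewrite gt_eqF // ltr_pwDl // (lt_le_trans hx).
Qed.

Lemma pos_neq0 d : pos d -> ev p d != 0.
Proof. by move=> /(_ 0 (lexx _)); rewrite scale0r addr0. Qed.

Lemma pos_nneg d : pos d -> nneg d.
Proof. by move=> hd t t0; apply: hd; exact: ltW. Qed.

Lemma nneg_add_e x t : nneg x -> 0 < t -> pos (x + t *: e).
Proof.
by move=> hx t0 s s0; rewrite -addrA -scalerDl; apply: hx; rewrite ltr_pwDl.
Qed.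

(** Openness of the cone along [e]: half of a positive lower bound of the roots may be
    subtracted. *)
Lemma pos_sub_e d : pos d -> exists2 t, 0 < t & pos (d - t *: e).
Proof.
move=> hd; have Er t := ev_roots d t e_neq0 hyperbolic_dir_e.
have [|b b0 hb] := @seq_gt0_lbound _ (hroots p e d).
  move=> a al; rewrite ltNge; apply/negP => a0.
  have /hd/eqP[] : 0 <= - a by rewrite oppr_ge0.
  by rewrite Er (big_rem a al) /= subrr mul0r mulr0.
exists (b / 2); first by lra.
move=> t t0; rewrite -addrA -scaleNr -scalerDl Er mulf_neq0 // prodf_seq_neq0.
by apply/allP => a /hb ba /=; rewrite gt_eqF //; lra.
Qed.

Lemma ev_pC_scale (w : 'rV[R[i]]_m) z : ev pC (z *: w) = z ^+ n * ev pC w.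
Proof. exact: evZ. Qed.

Lemma posZ c d : 0 < c -> pos d -> pos (c *: d).
Proof.
move=> c0 hd t t0; have -> : c *: d + t *: e = c *: (d + (t / c) *: e).
  by rewrite scalerDr scalerA mulrCA divff ?mulr1 // gt_eqF.
rewrite (evZ _ _ p_homog); apply: mulf_neq0.
  by rewrite expf_neq0 // gt_eqF.
by apply: hd; rewrite divr_ge0 // ltW.
Qed.

(* Homotopy [s |-> p (i e + s x + z v)]: for [s = 0] all roots [z] lie in the lower
   half-plane, and hyperbolicity in direction [e] forbids real roots. *)
Lemma garding_upper v x z : pos v -> 0 < Im z ->
  ev pC ('i *: cx e + cx x + z *: cx v) != 0.
Proof.
move=> hv Imz; apply: (path_no_upper_zero pC_homog) => //.
- by rewrite ev_pC fmorph_eq0 pos_neq0.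
- move=> s r _.
  have -> : 'i *: cx e + s%:C *: cx x + r%:C *: cx v = cx (s *: x + r *: v) + 'i *: cx e.
    by rewrite -addrA addrC cxD !cxZ.
  by apply: hyperbolic_dir_e; rewrite /= oner_eq0.
move=> {Imz}w Imw; have w0 : w != 0 by apply: contraTneq Imw => ->; rewrite ltxx.
have -> : 'i *: cx e + w *: cx v = w *: (cx v + ('i / w) *: cx e).
  by rewrite scalerDr scalerA mulrCA divff // mulr1 addrC.
rewrite ev_pC_scale mulf_neq0 ?expf_neq0 //.
(* If ['i / w] is a real [t], then [t * Im w = 1] makes [t] positive and positivity of [v] applies;
   otherwise hyperbolicity along [e] does. *)
have [Im0|] := eqVneq (Im ('i / w)) 0; last exact: hyperbolic_dir_e.
set t := Re ('i / w).
have Et : 'i / w = t%:C by rewrite /t; case: ('i / w) Im0 => a b /= ->.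
have t0 : 0 <= t.
  have : t%:C * w = 'i by rewrite -Et divfK.
  case: (w) Imw => a b /= b0 [_]; rewrite mul0r addr0 => tb.
  by rewrite -(pmulr_lge0 _ b0) tb ler01.
have -> : cx v + ('i / w) *: cx e = cx (v + t *: e).
  by rewrite Et cxD cxZ.
by rewrite ev_pC fmorph_eq0; apply: hv.
Qed.

(** Write [d = v + r *: e] with [v] still positive. The imaginary part of [z] then supplies a
    positive multiple of ['i *: cx e], and rescaling reduces to [garding_upper]. *)
Lemma garding d : pos d -> hyperbolic_dir d.
Proof.
move=> hd; have up x z : 0 < Im z -> ev pC (cx x + z *: cx d) != 0.
  move=> Imz; have [r r0 hv] := pos_sub_e hd.
  set v := d - r *: e in hv; case: z Imz => a b /= b0.
  have br : b * r != 0 by rewrite mulf_neq0 // gt_eqF.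
  have -> : cx x + (a +i* b) *: cx d = (b * r)%:C *:
      ('i *: cx e + cx ((b * r)^-1 *: (x + a *: d)) + (r^-1)*i *: cx v).
    rewrite [_ + cx (_ *: _)]addrC -/(cplx _ _) cplxDZ cplxZ [cx x]cplx0 cplxDZ.
    congr (cplx _ _); apply/matrixP => i j; rewrite !mxE; field; rewrite !gt_eqF //.
  rewrite ev_pC_scale mulf_neq0 ?expf_neq0 ?fmorph_eq0 //.
  by apply: garding_upper => //=; rewrite invr_gt0.
move=> x z Imz; have [Im0|Im0|Im0] := ltgtP (Im z) 0; last 1 first.
- by rewrite Im0 eqxx in Imz.
- have -> : cx x + z *: cx d = (- 1) *: (cx (- x) + (- z) *: cx d).
    by rewrite cxN scaleN1r opprD scaleNr !opprK.
  rewrite ev_pC_scale mulf_neq0 ?signr_eq0 //.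
  by apply: up; rewrite raddfN /= oppr_gt0.
exact: up.
Qed.

(* Homotopy from [e] to [x]: the roots of [w |-> p ((1 - s) e + s x - i w d)] are
   purely imaginary and never vanish, so none enters the upper half-plane. *)
Lemma pos_add_pos d x t : pos d -> pos x -> 0 <= t -> ev p (x + t *: d) != 0.
Proof.
move=> hd hx; rewrite le_eqVlt => /orP[/eqP <-|t0].
  by rewrite scale0r addr0 pos_neq0.
suff: ev pC (cx (x + t *: d)) != 0 by rewrite ev_pC fmorph_eq0.
(* Rotating the direction to [- 'i *: cx d] moves the parameter [t] to the point [0 +i* t] of the
   upper half-plane. *)
have -> : cx (x + t *: d) = cx e + cx (x - e) + (0 +i* t) *: (- 'i *: cx d).
  rewrite scalerA (_ : _ * _ = t%:C).
    by rewrite !cxD cxZ cxN addrCA subrr addr0.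
  by apply/eqP; rewrite eq_complex /=; apply/andP; split; apply/eqP; ring.
apply: (path_no_upper_zero pC_homog) => //.
- rewrite ev_pC_scale ev_pC mulf_neq0 ?fmorph_eq0 ?pos_neq0 // expf_neq0 //.
  by rewrite oppr_eq0 eq_complex /= oner_eq0 andbF.
- move=> s r /andP[s0 s1].
  have -> : cx e + s%:C *: cx (x - e) + r%:C *: (- 'i *: cx d) =
      cx ((1 - s) *: e + s *: x) + (0 -i* r) *: cx d.
    rewrite scalerA (_ : _ * _ = 0 -i* r).
      rewrite !cxD !cxZ cxN rmorphB rmorph1 scalerBl scale1r scalerDr scalerN.
      by rewrite addrCA [_ *: cx x + _]addrC.
    by apply/eqP; rewrite eq_complex /=; apply/andP; split; apply/eqP; ring.
  have [->|r0] := eqVneq r 0; last by apply: garding; rewrite //= oppr_eq0.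
  rewrite oppr0 complexr0 rmorph0 scale0r addr0 ev_pC fmorph_eq0.
  have [->|sn0] := eqVneq s 0; first by rewrite subr0 scale1r scale0r addr0.
  have sp : 0 < s by rewrite lt_neqAle eq_sym sn0.
  rewrite addrC; apply: (posZ sp hx); lra.
move=> w Imw; have {Imw} : 0 < Re (w * - 'i) by rewrite mulrN raddfN /= ReiNIm opprK.
rewrite scalerA; set y := w * - 'i => Rey.
have y0 : y != 0 by apply: contraTneq Rey => ->; rewrite ltxx.
have -> : cx e + y *: cx d = y *: (cx d + y^-1 *: cx e).
  by rewrite scalerDr scalerA divff // scale1r addrC.
rewrite ev_pC_scale mulf_neq0 ?expf_neq0 //.
have [Im0|] := eqVneq (Im y^-1) 0; last exact: hyperbolic_dir_e.
set r := Re y^-1.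
have Er : y^-1 = r%:C by rewrite /r; case: (y^-1) Im0 => a b /= ->.
have r0 : 0 <= r.
  have : r%:C * y = 1 by rewrite -Er mulVf.
  case: (y) Rey => a b /= a0 [+ _]; rewrite mul0r subr0 => ra.
  by rewrite -(pmulr_lge0 _ a0) ra ler01.
have -> : cx d + y^-1 *: cx e = cx (d + r *: e).
  by rewrite Er cxD cxZ.
by rewrite ev_pC fmorph_eq0; apply: hd.
Qed.

(** * Convexity of the cones, signs of [p] and of the roots *)

Lemma pos_nnegD u d : nneg u -> pos d -> pos (u + d).
Proof.
have H v : nneg u -> pos v -> ev p (u + v) != 0.
  move=> hu /pos_sub_e[r r0 hv].
  (* Moving a small multiple of [e] from [v] to [u] makes both summands positive. *)
  have -> : u + v = (u + r *: e) + 1 *: (v - r *: e).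
    by rewrite scale1r [v - _]addrC addrA addrK.
  by apply: pos_add_pos => //; apply: nneg_add_e.
move=> hu hd t t0; rewrite -addrA; apply: H => // s s0.
by rewrite -addrA -scalerDl; apply: hd; rewrite addr_ge0.
Qed.

Lemma pos_e : pos e.
Proof.
move=> t t0; rewrite -[X in X + _]scale1r -scalerDl (evZ _ _ p_homog) ev_e mulr1.
by rewrite expf_neq0 // gt_eqF // ltr_wpDr.
Qed.

Lemma nneg0 : nneg 0.
Proof.
move=> t t0; rewrite add0r (evZ _ _ p_homog) ev_e mulr1.
by rewrite expf_neq0 // gt_eqF.
Qed.

Lemma nnegZ c x : 0 <= c -> nneg x -> nneg (c *: x).
Proof.
rewrite le_eqVlt => /orP[/eqP <- _|c0 hx t t0].
  by rewrite scale0r; apply: nneg0.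
have -> : c *: x + t *: e = c *: (x + (t / c) *: e).
  by rewrite scalerDr scalerA mulrCA divff ?mulr1 // gt_eqF.
rewrite (evZ _ _ p_homog); apply: mulf_neq0; first by rewrite expf_neq0 // gt_eqF.
by apply: hx; rewrite divr_gt0.
Qed.

Lemma nnegD x y : nneg x -> nneg y -> nneg (x + y).
Proof.
move=> hx hy t t0; rewrite -addrA; apply: pos_neq0; apply: pos_nnegD => //.
exact: nneg_add_e.
Qed.

Lemma nneg_sum (I : Type) (l : seq I) (P : pred I) (x : I -> 'rV[R]_m) :
  (forall i, P i -> nneg (x i)) -> nneg (\sum_(i <- l | P i) x i).
Proof. by move=> hx; apply: big_ind => //; [exact: nneg0 | exact: nnegD]. Qed.

Lemma size_hroots d x : pos d -> size (hroots p d x) = n.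
Proof.
move=> hd; have [] // := hroots_dir x (pos_neq0 hd) (garding hd).
Qed.

Lemma hroots_ge0 d x a : pos d -> nneg x -> a \in hroots p d x -> 0 <= a.
Proof.
move=> hd hx al; rewrite leNgt; apply/negP => a0.
have /pos_neq0/eqP[] : pos (x + (- a) *: d).
  by apply: pos_nnegD => //; apply: posZ; rewrite ?oppr_gt0.
rewrite ev_roots ?pos_neq0 //; last exact: garding.
by rewrite (big_rem a al) /= subrr mul0r mulr0.
Qed.

Lemma nneg_ev_ge0 x : nneg x -> 0 <= ev p x.
Proof.
move=> hx; rewrite -[x]addr0 -(scale0r e) ev_roots //; last exact: hyperbolic_dir_e.
rewrite ev_e mul1r big_seq prodr_ge0 // => a al; rewrite addr0.
exact: hroots_ge0 pos_e hx al.
Qed.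

Lemma pos_ev_gt0 d : pos d -> 0 < ev p d.
Proof.
by move=> hd; rewrite lt_neqAle eq_sym pos_neq0 // nneg_ev_ge0 //; apply: pos_nneg.
Qed.

(** * Traces as logarithmic derivatives, and their monotonicity *)

Lemma ev_dir_roots d x t : pos d ->
  ev p (d + t *: x) = ev p d * \prod_(a <- hroots p d x) (1 + t * a).
Proof.
move=> hd; have [->|t0] := eqVneq t 0.
  rewrite scale0r addr0 big1 ?mulr1 // => a _; by rewrite mul0r addr0.
have -> : d + t *: x = t *: (x + t^-1 *: d).
  by rewrite scalerDr scalerA divff // scale1r addrC.
rewrite (evZ _ _ p_homog) ev_roots ?pos_neq0 //; last exact: garding.
rewrite mulrCA -(size_hroots x hd); congr (_ * _).
elim: (hroots p d x) => [|a l IH]; first by rewrite !big_nil mulr1.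
rewrite !big_cons /= -IH exprS; move: (_ ^+ _) (\prod_(_ <- _) _) => A B.
by field.
Qed.

(** Read off the linear coefficient of the factorization of [line p d x]. This form is linear in [x]
    and can be differentiated in [d]. *)
Lemma htraceE d x : pos d -> htrace p d x = dirder p x d / ev p d.
Proof.
move=> hd; rewrite -line_coef1.
have -> : line p d x = ev p d *: \prod_(a <- hroots p d x) (1 + a *: 'X).
  apply: poly_ext => t; rewrite horner_line ev_dir_roots // hornerZ horner_prod.
  by congr (_ * _); apply: eq_bigr => a _; rewrite !hornerE mulrC.
by rewrite coefZ (proj2 (coef_prod_1aX _)) mulrC mulKf ?pos_neq0.
Qed.

Lemma htraceZ d c x : pos d -> htrace p d (c *: x) = c * htrace p d x.
Proof. by move=> hd; rewrite !htraceE // dirderZ mulrA. Qed.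

Lemma htrace_sum d (I : Type) (l : seq I) (P : pred I) (x : I -> 'rV[R]_m) :
  pos d -> htrace p d (\sum_(i <- l | P i) x i) = \sum_(i <- l | P i) htrace p d (x i).
Proof.
move=> hd; rewrite htraceE // dirder_sum mulr_suml.
by apply: eq_bigr => i _; rewrite htraceE.
Qed.

Lemma htrace_self d : pos d -> htrace p d d = n%:R.
Proof.
move=> hd; rewrite /htrace -(size_hroots d hd).
have H a : a \in hroots p d d -> a = 1.
  move=> al; have : ev p (d + (- a) *: d) == 0.
    rewrite ev_roots ?pos_neq0 //; last exact: garding.
    by rewrite (big_rem a al) /= subrr mul0r mulr0.
  rewrite -[X in X + _]scale1r -scalerDl (evZ _ _ p_homog).
  rewrite mulf_eq0 (negPf (pos_neq0 hd)) orbF expf_eq0 n_gt0 subr_eq0.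
  by move/eqP.
elim: (hroots p d d) H => [|a l IH] H; first by rewrite big_nil.
rewrite big_cons /= (H a) ?mem_head // IH ?nat1r // => b bl.
by apply: H; rewrite inE bl orbT.
Qed.

Lemma htrace_ge0 d x : pos d -> nneg x -> 0 <= htrace p d x.
Proof.
by move=> hd hx; rewrite /htrace big_seq sumr_ge0 // => a; apply: hroots_ge0.
Qed.

Lemma deriv_line (q : mpoly m R) (a b : 'rV[R]_m) s :
  (line q a b)^`().[s] = dirder q b (a + s *: b).
Proof.
rewrite -line_coef1.
have -> : line q (a + s *: b) b = line q a b \Po ('X + s%:P).
  apply: poly_ext => t; rewrite horner_comp !horner_line !hornerE.
  by rewrite scalerDl addrA addrAC.
rewrite -[LHS]mulr1n -[RHS]mulr1n -[RHS]coef_deriv -horner_coef0 deriv_comp.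
by rewrite derivD derivX derivC addr0 mulr1 horner_comp !hornerE.
Qed.

(* For [Im z > 0] the roots of [r |-> p (w + z v + r u)] have negative imaginary
   part, so [z |-> D_u p (w + z v) / p (w + z v)] maps the upper half-plane to the
   lower one. *)
Lemma rayleigh_pos u v w : pos w -> nneg u -> pos v ->
  dirder (dirpoly p u) v w * ev p w - dirder p u w * dirder p v w <= 0.
Proof.
move=> hw hu hv.
have := @derive_quotient_le0 _ (line p w v) (line (dirpoly p u) w v) 0.
rewrite !deriv_line !horner_line scale0r addr0 ev_dirpoly; apply=> t t0.
rewrite !map_line map_dirder !horner_line ev_dirpoly.
rewrite -line_coef1 -(line_coef0 _ _ (cx u)); apply: Im_log_derivative => z.
rewrite rootE horner_line ltNge; case: z => x y /eqP pz; apply/negP => /= y0.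
have hvu : pos (t *: v + y *: u).
  by rewrite addrC; apply: pos_nnegD; [apply: nnegZ | apply: posZ].
have E0 : cx w + (0 +i* t) *: cx v = cplx w (t *: v).
  have := cplxDZ w 0 0 t v.
  by rewrite scale0r addr0 add0r -cplx0.
have E : cx w + (0 +i* t) *: cx v + (x +i* y) *: cx u =
    cplx (w + x *: u) (t *: v + y *: u).
  exact: etrans (congr1 (fun M : 'rV_m => M + (x +i* y) *: cx u) E0) (cplxDZ _ _ _ _ _).
have /eqP[] := @garding _ hvu (w + x *: u) 'i (oner_neq0 R).
rewrite -/(cplx _ _) -E.
exact: pz.
Qed.

(** The boundary case of [rayleigh_pos]: [v + t *: w] is positive for [t > 0], and the expression is
    affine in [t], so [t] may tend to 0. *)
Lemma rayleigh u v w : pos w -> nneg u -> nneg v ->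
  dirder (dirpoly p u) v w * ev p w - dirder p u w * dirder p v w <= 0.
Proof.
move=> hw hu hv; pose E x := dirder (dirpoly p u) x w * ev p w - dirder p u w * dirder p x w.
have : (E v)%:P.[0] + E w * 0 <= 0; last by rewrite hornerC mulr0 addr0.
have := @poly_le0_at0 _ ((E v)%:P + E w *: 'X); rewrite !hornerE; apply=> t t0.
rewrite !hornerE.
have -> : E v + E w * t = E (v + t *: w) by rewrite /E !dirderD !dirderZ; ring.
by apply: rayleigh_pos => //; apply: pos_nnegD => //; apply: posZ.
Qed.

(** Along [d + s *: v] the trace is a quotient of polynomials in [s], and [rayleigh] gives the sign
    of its derivative. *)
Lemma htrace_antimono d u v : pos d -> nneg u -> nneg v ->
  htrace p (d + v) u <= htrace p d u.
Proof.
move=> hd hu hv.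
have hs s : 0 <= s -> pos (d + s *: v).
  by move=> s0; rewrite addrC; apply: pos_nnegD => //; apply: nnegZ.
have h1 := hs 1 ler01; rewrite scale1r in h1.
have := @quotient_nonincreasing _ (line p d v) (line (dirpoly p u) d v).
rewrite !horner_line !ev_dirpoly scale0r addr0 scale1r !htraceE //; apply=> s s0.
  by rewrite horner_line; apply/pos_ev_gt0/hs.
by rewrite !deriv_line !horner_line ev_dirpoly; apply: rayleigh => //; apply: hs.
Qed.

Lemma hroots_le1 w x a : pos w -> nneg (w - x) -> a \in hroots p w x -> a <= 1.
Proof.
move=> hw hx al; rewrite leNgt; apply/negP => a1.
have /pos_neq0/eqP[] : pos ((w - x) + (a - 1) *: w).
  by apply: pos_nnegD => //; apply: posZ; rewrite ?subr_gt0.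
have -> : w - x + (a - 1) *: w = - (x + (- a) *: w).
  by apply/matrixP => i j; rewrite !mxE; ring.
rewrite evN ev_roots ?pos_neq0 //; last exact: garding.
by rewrite (big_rem a al) /= subrr mul0r !mulr0.
Qed.

Lemma htrace_scale2 c d x : 0 < c -> pos d ->
  htrace p (c *: d) (c *: x) = htrace p d x.
Proof.
move=> c0 hd; rewrite !htraceE //; last exact: posZ.
rewrite -!line_coef1.
have -> : line p (c *: d) (c *: x) = c ^+ n *: line p d x.
  apply: poly_ext => t; rewrite hornerZ !horner_line -(evZ _ _ p_homog).
  by rewrite scalerDr !scalerA mulrC.
rewrite coefZ (evZ _ _ p_homog) -mulf_div divff ?mul1r //.
by rewrite expf_neq0 // gt_eqF.
Qed.

(** Meant for iterates whose sum may have left the cone after an entry became 0. If [p] vanishes at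
    [d], the line polynomial is 0 and its root list is empty. *)
Lemma htrace0 d : htrace p d 0 = 0.
Proof.
rewrite /htrace /hroots; have [c0|c0] := eqVneq ((-1) ^+ n * ev p d) 0.
  suff -> : line_poly p 0 d = 0.
    by rewrite /real_roots rootsR0 big_seq big1.
  apply: poly_ext => t; rewrite line_polyE horner_line add0r scalerN evN.
  by rewrite (evZ _ _ p_homog) mulrCA c0 mulr0 horner0.
suff -> : line_poly p 0 d = ((-1) ^+ n * ev p d) *:
    \prod_(a <- nseq n 0) ('X - a%:P).
  rewrite (perm_big _ (real_roots_prod _ c0)) /= big_seq big1 // => a.
  by rewrite mem_nseq => /andP[_ /eqP].
apply: poly_ext => t; rewrite line_polyE horner_line add0r scalerN evN.
rewrite (evZ _ _ p_homog) hornerZ mulrCA [RHS]mulrC; congr (_ * _).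
rewrite horner_prod big_nseq; elim: (n) => //= k IH.
by rewrite exprS IH hornerXsubC subr0.
Qed.

(** * Positivity of the capacity *)

Implicit Types (X : 'I_n -> 'rV[R]_m) (A : 'I_n -> R).

(** Homogeneous form of a lower bound on the capacity: with no normalization of the product, it
    transforms simply when the entries are rescaled. *)
Definition cap_bound X c := forall A, (forall i, 0 < A i) ->
  c * \prod_i A i <= ev p (\sum_i A i *: X i).

Lemma nneg_comb X A : (forall i, nneg (X i)) -> (forall i, 0 <= A i) ->
  nneg (\sum_i A i *: X i).
Proof. by move=> hX hA; apply: nneg_sum => i _; apply: nnegZ. Qed.

Lemma Cap_gt0P X : (forall i, nneg (X i)) ->
  0 < Cap p X <-> exists2 c, 0 < c & cap_bound X c.
Proof.
move=> hX; rewrite /Cap; set E := (X in inf X).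
have lbE : has_lbound E.
  exists 0 => _ [A [A0 _ ->]]; apply: nneg_ev_ge0.
  by apply: nneg_comb => // i; apply: ltW.
have nR : n%:R != 0 :> R by rewrite pnatr_eq0 -lt0n.
split=> [cap0|[c c0 hc]].
  exists (inf E) => // A A0.
  have P0 : 0 < \prod_i A i by apply: prodr_gt0.
  (* Division by the geometric mean [g] normalizes the product to 1. *)
  pose g := powR (\prod_i A i) n%:R^-1.
  have g0 : 0 < g by apply: powR_gt0.
  have gn : g ^+ n = \prod_i A i.
    by rewrite -powR_mulrn ?(ltW g0) // -powRrM mulVf // powRr1 // ltW.
  have : inf E <= ev p (\sum_i (A i / g) *: X i).
    apply: ge_inf => //; exists (fun i => A i / g); split=> // [i|].
      by rewrite divr_gt0.
    rewrite big_split /= prodr_const card_ord exprVn gn divff // gt_eqF //.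
  have -> : \sum_i (A i / g) *: X i = g^-1 *: \sum_i A i *: X i.
    by rewrite scaler_sumr; apply: eq_bigr => i _; rewrite scalerA mulrC.
  by rewrite (evZ _ _ p_homog) exprVn gn ler_pdivlMl // mulrC.
apply: lt_le_trans c0 _; apply: lb_le_inf.
  exists (ev p (\sum_i 1 *: X i)), (fun=> 1).
  by split=> //; rewrite big1.
by move=> _ [A [A0 A1 ->]]; have := hc A A0; rewrite A1 mulr1.
Qed.

Lemma cap_boundZ X B c : (forall i, 0 < B i) ->
  cap_bound (fun i => B i *: X i) c <-> cap_bound X (c / \prod_i B i).
Proof.
move=> B0; have P0 : \prod_i B i != 0 by rewrite gt_eqF // prodr_gt0.
split=> hc A A0.
  have /hc : forall i, 0 < A i / B i by move=> i; rewrite divr_gt0.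
  rewrite big_split /= prodfV [c / _ * _]mulrAC -mulrA => /le_trans; apply.
  rewrite le_eqVlt; apply/orP; left; apply/eqP; congr (ev p _).
  by apply: eq_bigr => i _; rewrite scalerA divfK // gt_eqF.
have /hc : forall i, 0 < A i * B i by move=> i; rewrite mulr_gt0.
rewrite big_split /= [_ * \prod_i B i]mulrC mulrA divfK // => /le_trans; apply.
rewrite le_eqVlt; apply/orP; left; apply/eqP; congr (ev p _).
by apply: eq_bigr => i _; rewrite scalerA.
Qed.

(** * One Sinkhorn step, and the capacity bound from a small defect *)

Section NonnegativeTuple.
Variable X : 'I_n -> 'rV[R]_m.
Hypotheses (hX : forall i, nneg (X i)) (hd : pos (tuple_sum X)).
Let d := tuple_sum X.
Let tr i := htrace p d (X i).

Lemma sum_htrace : \sum_i tr i = n%:R.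
Proof. by rewrite /tr -htrace_sum // htrace_self. Qed.

Lemma tr_ge0 i : 0 <= tr i. Proof. exact: htrace_ge0. Qed.

Lemma tr_len i : tr i <= n%:R.
Proof. by rewrite -sum_htrace (bigD1 i) //= lerDl sumr_ge0 // => j _; apply: tr_ge0. Qed.

Lemma nneg_HS i : nneg (HS p X i).
Proof. by apply: nnegZ => //; rewrite invr_ge0 tr_ge0. Qed.

Lemma pos_HS : (forall i, 0 < tr i) -> pos (tuple_sum (HS p X)).
Proof.
move=> t0; have nR : 0 < n%:R :> R by rewrite ltr0n.
(* Since no trace exceeds [n%:R], the new sum dominates a positive multiple of [d]. *)
have -> : tuple_sum (HS p X) =
    \sum_i ((tr i)^-1 - n%:R^-1) *: X i + n%:R^-1 *: d.
  rewrite scaler_sumr -big_split; apply: eq_bigr => i _ /=.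
  by rewrite -scalerDl subrK.
apply: pos_nnegD; last by apply: posZ; rewrite ?invr_gt0.
apply: nneg_comb => // i; rewrite subr_ge0 lef_pV2 ?posrE //; exact: tr_len.
Qed.

(** Every rescaled entry has trace 1 along [d], so the [n] roots of the new sum are nonnegative and
    add up to [n]. AM-GM bounds their product, which is the ratio of the two values of [p]. *)
Lemma ev_HS_le : (forall i, 0 < tr i) -> ev p (tuple_sum (HS p X)) <= ev p d.
Proof.
move=> t0; set d' := tuple_sum _; have hd' : pos d' by apply: pos_HS.
rewrite -[d']addr0 -(scale0r d) ev_roots ?pos_neq0 //; last exact: garding.
rewrite ger_pMr ?pos_ev_gt0 //; under eq_bigr do rewrite addr0.
apply: prod_le1_of_sum => [a|]; first by apply: hroots_ge0 => //; apply: pos_nneg.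
rewrite size_hroots // -[LHS]/(htrace p d d') htrace_sum //.
rewrite (eq_bigr (fun=> 1)) ?sumr_const ?card_ord // => i _.
by rewrite htraceZ // mulVf //; apply: lt0r_neq0 (t0 i).
Qed.

(* Adding a multiple of an entry of trace 0 leaves [p] unchanged. *)
Lemma cap_bound_tr_gt0 c : 0 < c -> cap_bound X c -> forall i, 0 < tr i.
Proof.
move=> c0 hc i; rewrite lt_neqAle tr_ge0 andbT eq_sym; apply/eqP => ti.
have r0 a : a \in hroots p d (X i) -> a = 0.
  move=> al; move: ti; rewrite /tr /htrace (big_rem a al) /=.
  have a0 := hroots_ge0 hd (hX i) al.
  have : 0 <= \sum_(b <- rem a (hroots p d (X i))) b.
    by rewrite big_seq sumr_ge0 // => b /mem_rem; apply: hroots_ge0.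
  lra.
have pd := pos_ev_gt0 hd.
(* With this [s], the lower bound [c * (1 + s)] equals [ev p d + c], more than the unchanged value
   [ev p d]. *)
pose s := ev p d / c; have s0 : 0 < s by apply: divr_gt0.
have := hc (fun j => if j == i then 1 + s else 1).
have -> : \sum_j (if j == i then 1 + s else 1) *: X j = d + s *: X i.
  rewrite (bigD1 i) //= eqxx /d /tuple_sum [X in _ = X + _](bigD1 i) //=.
  rewrite scalerDl scale1r addrAC; congr (_ + _ + _).
  by apply: eq_bigr => j /negPf ->; rewrite scale1r.
rewrite (bigD1 i) //= eqxx big1 ?mulr1; last by move=> j /negPf ->.
rewrite ev_dir_roots // big_seq big1 ?mulr1; last first.
  by move=> a /r0 ->; rewrite mulr0 addr0.
move=> /(_ _) h; have : c * (1 + s) <= ev p d.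
  by apply: h => j; case: eqP => _ //; rewrite ltr_wpDl.
rewrite mulrDr mulr1 /s mulrCA divff ?gt_eqF // mulr1. lra.
Qed.

Let delta : R := (2 * n%:R)^-1.

Let nR_ge1 : 1 <= n%:R :> R. Proof. by rewrite ler1n. Qed.

Let delta_gt0 : 0 < delta.
Proof. by rewrite invr_gt0; move: nR_ge1; lra. Qed.

Let delta_le1 : delta <= 1.
Proof. by rewrite invf_le1; move: nR_ge1; lra. Qed.

(** Summing [1 - t <= n / 2 * (t - 1) ^+ 2 + 1 / (2 * n)] over a proper subset, the squares
    contribute at most 1/2 and the constants at most [1 / 2 - delta]. The full set has the exact sum
    [n]. *)
Lemma tr_subset_ge (S : {set 'I_n}) : DS p X <= n%:R^-1 ->
  #|S|%:R - 1 + delta <= \sum_(i in S) tr i.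
Proof.
move=> hDS; have nR : 0 < n%:R :> R by rewrite ltr0n.
have [->|SnT] := eqVneq S [set: 'I_n]%SET.
  rewrite cardsT card_ord (eq_bigl predT) ?sum_htrace; last by move=> i; rewrite inE.
  by move: delta_le1; lra.
have cS : #|S|%:R + 1 <= n%:R :> R.
  rewrite natr1 ler_nat -[leqRHS]card_ord -cardsT; apply: proper_card.
  by rewrite properT.
have H1 : \sum_(i in S) (1 - tr i) <=
    \sum_(i in S) (n%:R / 2 * (tr i - 1) ^+ 2 + (2 * n%:R)^-1).
  apply: ler_sum => i _; rewrite -subr_ge0.
  have -> : n%:R / 2 * (tr i - 1) ^+ 2 + (2 * n%:R)^-1 - (1 - tr i) =
    n%:R / 2 * (tr i - 1 + n%:R^-1) ^+ 2 by field; rewrite gt_eqF.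
  by rewrite mulr_ge0 ?sqr_ge0 // divr_ge0 // ltW.
have H2 : \sum_(i in S) (tr i - 1) ^+ 2 <= n%:R^-1.
  apply: le_trans hDS; rewrite /DS [leRHS](bigID (mem S)) /= lerDl sumr_ge0 //.
  by move=> i _; apply: sqr_ge0.
have H3 : n%:R / 2 * (\sum_(i in S) (tr i - 1) ^+ 2) <= 1 / 2.
  have -> : 1 / 2 = n%:R / 2 * n%:R^-1 :> R by field; rewrite gt_eqF.
  by rewrite ler_wpM2l // divr_ge0 // ltW.
have H4 : #|S|%:R * (2 * n%:R)^-1 <= 1 / 2 - delta.
  have -> : 1 / 2 - delta = (n%:R - 1) * (2 * n%:R)^-1 by rewrite /delta; field; rewrite gt_eqF.
  by rewrite ler_wpM2r ?invr_ge0 ?mulr_ge0 //; lra.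
move: H1; rewrite sumrB big_split /= -mulr_sumr !sumr_const.
rewrite -[(2 * n%:R)^-1 *+ _]mulr_natl; lra.
Qed.

(* The roots of [x] in direction [w] lie in [[0, 1]], and their sum is at least
   [htrace p d (\sum_(i in S) X i) > #|S| - 1] because [w <= M' *: d]. *)
Lemma lower_max A (S : {set 'I_n}) M M' :
  DS p X <= n%:R^-1 -> (0 < #|S|)%N -> 0 < M' -> M' <= M ->
  (forall i, i \in S -> A i = M) ->
  (forall i, i \notin S -> 0 < A i <= M') ->
  delta * (M / M') ^+ #|S| *
    ev p (\sum_i (if i \in S then M' else A i) *: X i)
  <= ev p (\sum_i A i *: X i).
Proof.
move=> hDS S0 M'0 MM' AS AnS.
pose A' i := if i \in S then M' else A i; set w := \sum_i _.
have A'0 i : 0 < A' i by rewrite /A'; case: ifPn => // /AnS /andP[].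
have A'M i : A' i <= M' by rewrite /A'; case: ifPn => // /AnS /andP[].
have tri_sub b : (forall i, b < A' i) -> 0 < b -> pos w.
  move=> bA b0; have -> : w = \sum_i (A' i - b) *: X i + b *: d.
    rewrite scaler_sumr -big_split; apply: eq_bigr => i _ /=.
    by rewrite -scalerDl subrK.
  apply: pos_nnegD; last exact: posZ.
  by apply: nneg_comb => // i; rewrite subr_ge0 ltW.
have hw : pos w.
  have [|b b0 hb] := @seq_gt0_lbound _ [seq A' i | i : 'I_n].
    by move=> _ /mapP[i _ ->].
  apply: (tri_sub (b / 2)); last by lra.
  move=> i; have /hb : A' i \in [seq A' j | j : 'I_n].
    by apply/mapP; exists i; rewrite ?mem_enum.
  lra.
pose x := M' *: \sum_(i in S) X i.
have hx : nneg x by apply: nnegZ; [exact: ltW | apply: nneg_sum].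
have hwx : nneg (w - x).
  have -> : w - x = \sum_(i | i \notin S) A i *: X i.
    rewrite /w (bigID (mem S)) /= /x scaler_sumr.
    rewrite (eq_bigr (fun i => M' *: X i)); last by move=> i ->.
    rewrite addrAC subrr add0r; apply: eq_bigr => i /negPf -> //.
  by apply: nneg_sum => i /AnS /andP[/ltW Ai _]; apply: nnegZ.
have E : \sum_i A i *: X i = w + (M / M' - 1) *: x.
  rewrite /w /x scalerA mulrBl divfK ?gt_eqF // mul1r scaler_sumr.
  rewrite (bigID (mem S)) /= [in RHS](bigID (mem S)) /= addrAC -big_split /=.
  congr (_ + _).
    by apply: eq_bigr => i iS; rewrite AS // iS -scalerDl addrC subrK.
  by apply: eq_bigr => i /negPf ->.
have beta0 : 0 <= M / M' - 1 by rewrite subr_ge0 ler_pdivlMr // mul1r.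
rewrite E ev_dir_roots // mulrC ler_wpM2l ?(ltW (pos_ev_gt0 hw)) //.
have d01 : 0 <= delta <= 1 by rewrite ltW.
have sum_mu : #|S|.-1%:R + delta <= \sum_(a <- hroots p w x) a.
  apply: (@le_trans _ _ (\sum_(i in S) tr i)).
    by have := tr_subset_ge S hDS; rewrite -{1}(prednK S0) -natr1; lra.
  rewrite -htrace_sum // -(htrace_scale2 _ M'0 hd) -/x -[leRHS]/(htrace p w x).
  have -> : M' *: d = w + \sum_i (M' - A' i) *: X i.
    rewrite /w -big_split /= scaler_sumr; apply: eq_bigr => i _.
    by rewrite -scalerDl addrC subrK.
  apply: htrace_antimono => //; apply: nneg_comb => // i.
  by rewrite subr_ge0.
have := prod_ge_of_sum beta0 d01 _ sum_mu; rewrite addrC subrK => h.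
apply: le_trans (h _); last first.
  by move=> a al; rewrite (hroots_ge0 hw hx al) (hroots_le1 hw hwx al).
(* What remains is [delta * (1 + b) <= 1 + b * delta], true because [delta <= 1]. *)
rewrite -{1}(prednK S0) exprSr mulrCA ler_wpM2l ?exprn_ge0 //.
  by rewrite divr_ge0 ?ltW // (lt_le_trans M'0).
case/andP: d01 => d0 d1.
set b := M / M' - 1 in beta0 *; have -> : M / M' = 1 + b by rewrite /b addrC subrK.
nra.
Qed.

(* Induction on the number of entries of [A] below the maximum [M]: lowering the
   maximal entries to the second largest value enlarges the maximal set. *)
Lemma cap_bound_max N A M : DS p X <= n%:R^-1 ->
  (forall i, 0 < A i <= M) -> (0 < #|[set i | A i == M]%SET|)%N ->
  (n - #|[set i | A i == M]%SET| <= N)%N ->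
  delta ^+ N * ev p d * \prod_i A i <= ev p (\sum_i A i *: X i).
Proof.
move=> hDS; have pd := pos_ev_gt0 hd.
have const k B M1 : (forall i, B i = M1) -> 0 < M1 ->
    delta ^+ k * ev p d * \prod_i B i <= ev p (\sum_i B i *: X i).
  move=> BM M0; rewrite (eq_bigr (fun=> M1)) // prodr_const card_ord.
  have -> : \sum_i B i *: X i = M1 *: d.
    by rewrite scaler_sumr; apply: eq_bigr => i _; rewrite BM.
  rewrite (evZ _ _ p_homog) [leRHS]mulrC -mulrA; apply: ler_piMl.
    by rewrite mulr_ge0 ?exprn_ge0 // ltW.
  by rewrite exprn_ile1 // ltW.
elim: N A M => [|N IH] A M AM S0; set S := [set i | A i == M]%SET in S0 * => nS.
  apply: (const 0%N A M); last first.
    by have /andP[a b] := AM (Ordinal n_gt0); apply: lt_le_trans b.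
  move=> i; have : i \in S; last by rewrite inE => /eqP.
  suff -> : S = [set: 'I_n]%SET by rewrite inE.
  apply/eqP; rewrite eqEcard finset.subsetT cardsT card_ord.
  by rewrite -subn_eq0 -leqn0.
have Mgt0 : 0 < M.
  by have /andP[a b] := AM (Ordinal n_gt0); apply: lt_le_trans b.
have AS i : i \in S -> A i = M by rewrite inE => /eqP.
case: (pickP (fun i => i \notin S)) => [i1 i1S | allS]; last first.
  by apply: (const _ _ M) => // i; apply: AS; have := allS i => /negbFE.
have [i0 i0S hmax] := @arg_maxP _ _ _ i1 (fun i => i \notin S) A i1S.
have /andP[A0 _] := AM i0.
have lt_i0 : A i0 < M.
  by move: i0S; rewrite inE lt_neqAle => -> /=; have /andP[] := AM i0.
pose A' i := if i \in S then A i0 else A i.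
have A'M i : 0 < A' i <= A i0.
  rewrite /A'; case: ifPn => [_|iS]; first by rewrite A0 lexx.
  by have /andP[-> _] := AM i; apply: hmax.
have SS : (#|S| < #|[set i | A' i == A i0]%SET|)%N.
  apply: (@leq_trans #|i0 |: S|%SET); first by rewrite cardsU1 i0S.
  apply/subset_leq_card/fintype.subsetP => i.
  rewrite in_setU1 inE /A' => /orP[/eqP ->|->]; last exact: eqxx.
  by rewrite (negPf i0S).
have := IH A' (A i0) A'M; move=> /(_ _ _) H.
have {}H : delta ^+ N * ev p d * \prod_i A' i <= ev p (\sum_i A' i *: X i).
  apply: H; first exact: leq_ltn_trans SS.
  move: nS; rewrite !leq_subLR => nS; apply: leq_trans nS _.
  by rewrite addnS -addSn leq_add2r.
have := @lower_max A S M (A i0) hDS S0 A0 (ltW lt_i0) AS.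
move=> /(_ _) L.
have {}L : delta * (M / A i0) ^+ #|S| * ev p (\sum_i A' i *: X i) <=
    ev p (\sum_i A i *: X i).
  by apply: L => i iS; have /andP[-> _] := AM i; apply: hmax.
apply: le_trans L.
have -> : \prod_i A i = (M / A i0) ^+ #|S| * \prod_i A' i.
  have -> : (M / A i0) ^+ #|S| = \prod_i (if i \in S then M / A i0 else 1).
    by rewrite -big_mkcond /= prodr_const.
  rewrite -big_split /=; apply: eq_bigr => i _.
  rewrite /A'; case: ifPn => iS; last by rewrite mul1r.
  by rewrite divfK ?gt_eqF // AS.
have B0 : 0 <= delta * (M / A i0) ^+ #|S|.
  by rewrite mulr_ge0 ?exprn_ge0 ?divr_ge0 // ltW.
apply: le_trans (ler_wpM2l B0 H).
by rewrite le_eqVlt; apply/orP; left; apply/eqP; rewrite exprS; ring.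
Qed.

Lemma cap_bound_DS : DS p X <= n%:R^-1 -> exists2 c, 0 < c & cap_bound X c.
Proof.
move=> hDS; exists (delta ^+ n * ev p d).
  by rewrite mulr_gt0 ?exprn_gt0 // pos_ev_gt0.
move=> A A0; have [i0 _ hmax] := @arg_maxP _ _ _ (Ordinal n_gt0) predT A isT.
apply: (@cap_bound_max n A (A i0)) => //; last by rewrite leq_subr.
  by move=> i; rewrite A0; apply: hmax.
by apply/card_gt0P; exists i0; rewrite inE.
Qed.

Lemma HS_tr : (forall i, 0 < tr i) -> forall c, cap_bound X c ->
  cap_bound (HS p X) (c / \prod_i tr i).
Proof.
move=> t0 c hc; have t1 i : 0 < (tr i)^-1 by rewrite invr_gt0.
by apply/cap_boundZ; rewrite ?prodfV // invrK divfK // gt_eqF // prodr_gt0.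
Qed.

Lemma prod_tr : (forall i, 0 < tr i) -> \prod_i tr i <= 1.
Proof. by move=> t0; apply: prod_le1_ord sum_htrace => i; exact: ltW. Qed.

Lemma DS_le : (forall i, 0 < tr i) ->
  DS p X <= 4 * n%:R * ((\prod_i tr i)^-1 - 1).
Proof. by move=> t0; apply: sum_sqr_dist1_le t0 sum_htrace. Qed.

End NonnegativeTuple.

(** * Iteration of the Sinkhorn map *)

Lemma sinkhorn_zero X j i : X i = 0 -> sinkhorn p X j i = 0.
Proof.
elim: j X => [|j IH] X Xi //; rewrite /sinkhorn iterSr; apply: IH.
by rewrite /HS Xi scaler0.
Qed.

(** Each step rescales the entries by positive factors, so the bound for the last iterate pulls back
    to the first, unless some trace is 0. *)
Lemma cap_bound_of_DS X j : (forall i, nneg (X i)) -> pos (tuple_sum X) ->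
  DS p (sinkhorn p X j) <= n%:R^-1 -> exists2 c, 0 < c & cap_bound X c.
Proof.
elim: j X => [|j IH] X hX hd; first exact: cap_bound_DS.
rewrite /sinkhorn iterSr -/(sinkhorn p _ j) => hDS.
pose tr i := htrace p (tuple_sum X) (X i).
have [t0|/existsNP[i ti]] := pselect (forall i, 0 < tr i).
  have [c c0 hc] := IH _ (nneg_HS hX hd) (pos_HS hX hd t0) hDS.
  have t1 i : 0 < (tr i)^-1 by rewrite invr_gt0.
  exists (c / \prod_i (tr i)^-1); last exact: (cap_boundZ X c t1).1 hc.
  by rewrite divr_gt0 // prodr_gt0.
have {}ti : tr i = 0.
  by apply/eqP; rewrite eq_le tr_ge0 // andbT leNgt; apply/negP.
(* The traces add up to [n], so for [n = 1] the only trace is 1. Hence a zero trace forces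
   [n%:R^-1 < 1], while the entry, zero from now on, alone contributes 1 to every later defect. *)
have n2 : (1 < n)%N.
  rewrite ltn_neqAle n_gt0 andbT; apply/eqP => n1.
  have st := sum_htrace hd; rewrite (bigD1 i) //= -/(tr i) ti add0r in st.
  have : \sum_(k < n | k != i) tr k = 0.
    apply: big1 => k; have := ltn_ord k; have := ltn_ord i; rewrite -{2 4}n1 !ltnS !leqn0.
    by move=> /eqP i0 /eqP k0 /eqP[]; apply: val_inj; rewrite /= i0 k0.
  by rewrite st => /eqP; rewrite pnatr_eq0 => /eqP n0; move: n_gt0; rewrite n0.
have : 1 <= DS p (sinkhorn p (HS p X) j).
  rewrite /DS (bigD1 i) //= sinkhorn_zero; last first.
    by rewrite /HS -/(tr i) ti invr0 scale0r.
  rewrite htrace0 sub0r sqrrN expr1n lerDl sumr_ge0 // => k _; exact: sqr_ge0.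
move/le_trans/(_ hDS); rewrite leNgt invf_lt1 ?ltr0n //.
by rewrite ltr1n n2.
Qed.

Lemma sinkhorn_cvg X c : (forall i, nneg (X i)) -> pos (tuple_sum X) ->
  0 < c -> cap_bound X c ->
  (DS p (sinkhorn p X j) @[j --> \oo] --> (0 : R))%classic.
Proof.
move=> hX hd c0 hc; pose S j := sinkhorn p X j.
pose P j := \prod_i htrace p (tuple_sum (S j)) (S j i).
(* The accumulated scaling: each [P l] is at most 1, and a step turns the capacity constant
   [c * B j] into [c * B j.+1]. *)
pose B j := \prod_(l < j) (P l)^-1.
have BS j : B j.+1 = B j / P j by rewrite /B big_ord_recr.
have inv j : [/\ forall i, nneg (S j i), pos (tuple_sum (S j)),
    cap_bound (S j) (c * B j), ev p (tuple_sum (S j)) <= ev p (tuple_sum X) &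
    1 <= B j].
  elim: j => [|j [h1 h2 h3 h4 h5]]; first by rewrite /B big_ord0 mulr1; split.
  have t0 := cap_bound_tr_gt0 h1 h2 (mulr_gt0 c0 (lt_le_trans ltr01 h5)) h3.
  have -> : S j.+1 = HS p (S j) by [].
  split.
  - exact: nneg_HS.
  - exact: pos_HS.
  - by rewrite BS mulrA; apply: HS_tr.
  - exact: le_trans (ev_HS_le h1 h2 t0) h4.
  - rewrite BS (le_trans h5) // ler_peMr ?(le_trans ler01) //.
    by rewrite invf_ge1 ?prod_tr // prodr_gt0.
have step j : 0 <= DS p (S j) <= 4 * n%:R * (B j.+1 - B j).
  have [h1 h2 h3 _ h5] := inv j.
  have t0 := cap_bound_tr_gt0 h1 h2 (mulr_gt0 c0 (lt_le_trans ltr01 h5)) h3.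
  have P1 : 1 <= (P j)^-1 by rewrite invf_ge1 ?prod_tr // prodr_gt0.
  apply/andP; split; first by apply: sumr_ge0 => i _; apply: sqr_ge0.
  apply: le_trans (DS_le h2 t0) _; rewrite ler_wpM2l ?mulr_ge0 // BS.
  have -> : B j / P j - B j = B j * ((P j)^-1 - 1) by rewrite mulrBr mulr1.
  by rewrite ler_peMl // subr_ge0.
have Bcvg : (cvgn B)%classic.
  apply: nondecreasing_is_cvgn.
    apply/nondecreasing_seqP => j; rewrite -subr_ge0.
    have /andP[a b] := step j; have := le_trans a b.
    by rewrite pmulr_rge0 // mulr_gt0 // ltr0n.
  (* The capacity bound at constant coefficients 1 gives [c * B j] at most the value of [p] at the
     current sum, which never exceeds the initial one. *)
  exists (ev p (tuple_sum X) / c) => _ [j _ <-].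
  have [h1 h2 h3 h4 h5] := inv j.
  have := h3 (fun=> 1) (fun=> ltr01); rewrite big1 // mulr1 => h.
  rewrite ler_pdivlMr // mulrC (le_trans h) //.
  by under eq_bigr do rewrite scale1r.
(* The defect is squeezed by the increments of the convergent sequence [B]. *)
apply: (@squeeze_cvgr _ _ _ _ (fun=> 0) (fun j => 4 * n%:R * (B j.+1 - B j))).
- by apply: nearW => j; apply: step.
- exact: cvg_cst.
rewrite -[X in (_ --> X)%classic](mulr0 (4 * n%:R)); apply: cvgM.
  exact: cvg_cst.
rewrite -(subrr (limn B)); apply: cvgB => //.
by rewrite (cvg_shiftS B).
Qed.

End Hyperbolic.

Local Close Scope complex_scope.
Local Open Scope classical_set_scope.

Theorem theorem2p12 (R : realType) (m n : nat) (p : mpoly m R)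
    (e : 'rV[R]_m) (X0 : 'I_n -> 'rV[R]_m)
    (n_gt0 : (0 < n)%N)
    (p_homog : p \is ishomog1 n (@mdeg m))
    (p_hyp : hyperbolic n p e)
    (p_e : peval p e = 1)
    (X0_nonneg : forall i : 'I_n, e_nonneg n p e (X0 i))
    (d0_pos : e_positive n p e (tuple_sum X0)) :
  ((exists j : nat, DS p (sinkhorn p X0 j) <= n%:R^-1) <-> 0 < Cap p X0) /\
  (0 < Cap p X0 <-> DS p (sinkhorn p X0 j) @[j --> \oo] --> (0 : R)).
Proof.
have hX i : nneg p e (X0 i) := nneg_e_nonneg n_gt0 p_homog p_hyp p_e (X0_nonneg i).
have hd : pos p e (tuple_sum X0) := pos_e_positive n_gt0 p_homog p_hyp p_e d0_pos.
have CapP := Cap_gt0P n_gt0 p_homog p_hyp p_e hX.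
have DS_Cap : (exists j, DS p (sinkhorn p X0 j) <= n%:R^-1) -> 0 < Cap p X0.
  by case=> j hj; apply/CapP; apply: cap_bound_of_DS hj.
have Cap_cvg : 0 < Cap p X0 -> DS p (sinkhorn p X0 j) @[j --> \oo] --> (0 : R).
  by move=> /CapP[c c0 hc]; apply: sinkhorn_cvg hc.
have cvg_DS : DS p (sinkhorn p X0 j) @[j --> \oo] --> (0 : R) ->
    exists j, DS p (sinkhorn p X0 j) <= n%:R^-1.
  move=> h; have n0 : 0 < n%:R^-1 :> R by rewrite invr_gt0 ltr0n.
  move/cvgrPdist_lt : h => /(_ _ n0)[N _ /(_ N (leqnn N)) /=].
  by rewrite sub0r normrN => /(le_lt_trans (ler_norm _))/ltW; exists N.
split; split=> //; first by move=> /Cap_cvg/cvg_DS.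
by move=> /cvg_DS/DS_Cap.
Qed.
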